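(* Let $\mathcal{M}$ be a complex supermanifold. The map of sheaves of abelian groups $\exp:\mathcal{O}_{\mathcal{M},0}\to\mathcal{O}^*_{\mathcal{M},0}$, given on sections over an open set $\mathcal{U}$ by $s_0\mapsto e^{2\pi i s_0}$, is surjective (as a map of sheaves) and $\ker(\exp)=\mathbb{Z}_{\mathcal{M}}$.
   Context: A complex supermanifold $\mathcal{M}=(|\mathcal{M}|,\mathcal{O}_{\mathcal{M}})$ is a locally ringed space with a sheaf of superalgebras locally isomorphic to $\mathbb{C}^{n|m}=(\mathbb{C}^n,\mathcal{O}_{\mathbb{C}^n}\otimes\bigwedge[\xi_1,\ldots,\xi_m])$. $\mathcal{O}_{\mathcal{M},0}$ is the even part of the structure sheaf (an additive sheaf of abelian groups), $\mathcal{O}^*_{\mathcal{M},0}$ is the even part of the sheaf of invertible elements of $\mathcal{O}_{\mathcal{M}}$, i.e. even sections whose reduced part (image in $\mathcal{O}_{\mathcal{M}_{red}}$) is nowhere zero (a multiplicative sheaf of abelian groups), and $\mathbb{Z}_{\mathcal{M}}$ is the sheaf of locally constant integer-valued functions on $|\mathcal{M}|$. *)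

(* Defs.v *)
From HB Require Import structures.
From mathcomp Require Import all_boot all_order all_algebra.
From mathcomp Require Import complex ring.
From mathcomp Require Import all_classical all_reals all_analysis.
Import Order.TTheory GRing.Theory Num.Theory.
Import numFieldNormedType.Exports.

Set Implicit Arguments.
Unset Strict Implicit.
Unset Printing Implicit Defensive.

Local Open Scope ring_scope.

(* The exterior algebra A ⊗ ⋀[ξ_0, …, ξ_(m-1)], as the free A-module on the
   monomials ξ_I = ∏_(i ∈ I) ξ_i (increasing order), I ⊆ 'I_m. *)
Definition grassmann (m : nat) (A : comPzRingType) : Type :=
  {ffun {set 'I_m} -> A}.

HB.instance Definition _ m A := GRing.Zmodule.on (grassmann m A).

(* ξ_I ξ_J = (-1)^(inversions I J) ξ_(I ∪ J) for disjoint I and J *)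
Definition inversions m (I J : {set 'I_m}) : nat :=
  \sum_(i in I) \sum_(j in J) (j < i)%N.

Section GrassmannRing.
Variables (m : nat) (A : comPzRingType).
Implicit Types (a b c : grassmann m A) (I J K S : {set 'I_m}).

Definition grassmann_one : grassmann m A := [ffun S : {set 'I_m} => (S == finset.set0)%:R].

Definition grassmann_mul a b : grassmann m A :=
  [ffun S : {set 'I_m} => \sum_(I : {set 'I_m} | I \subset S)
     (-1) ^+ inversions I (S :\: I) * a I * b (S :\: I)].

Lemma inversionsUl I J K : [disjoint I & J] ->
  inversions (I :|: J) K = (inversions I K + inversions J K)%N.
Proof. by move=> dIJ; rewrite /inversions -bigU //=; apply: eq_bigl => i; rewrite inE. Qed.

Lemma inversionsUr I J K : [disjoint J & K] ->
  inversions I (J :|: K) = (inversions I J + inversions I K)%N.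
Proof.
move=> dJK; rewrite /inversions -big_split; apply: eq_bigr => i _ /=.
by rewrite -bigU //=; apply: eq_bigl => j; rewrite inE.
Qed.

Lemma inversionsC I J : [disjoint I & J] ->
  (inversions I J + inversions J I = #|I| * #|J|)%N.
Proof.
move=> dIJ; rewrite /inversions [X in (_ + X)%N]exchange_big -big_split /=.
under eq_bigr => i iI.
  rewrite -big_split /=.
  under eq_bigr => j jJ.
    have -> : ((j < i) + (i < j) = 1)%N.
      have : (i != j :> nat).
        by apply/eqP => /val_inj ij; move/finset.disjoint_setI0: dIJ => /setP /(_ i);
          rewrite !inE iI ij jJ.
      by case: ltngtP.
    over.
  rewrite sum1_card; over.
by rewrite sum_nat_const.
Qed.

Lemma grassmann_mulA : associative grassmann_mul.
Proof.
move=> a b c; apply/ffunP => S; rewrite !ffunE.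
transitivity (\sum_(I : {set 'I_m} | I \subset S)
   \sum_(K : {set 'I_m} | (I \subset K) && (K \subset S))
     (-1) ^+ (inversions I (K :\: I) + inversions K (S :\: K))
       * a I * b (K :\: I) * c (S :\: K)).
  apply: eq_bigr => I IS; rewrite ffunE mulr_sumr.
  rewrite [RHS](reindex_onto (fun J => I :|: J) (fun K => K :\: I)) /=; last first.
    move=> K /andP[/fintype.subsetP IK _]; apply/setP => x; rewrite !inE.
    by case: (boolP (x \in I)) => // /IK ->.
  apply: eq_big => [J|J JSI].
    rewrite finset.subsetUl finset.subUset IS /= finset.subsetD.
    congr (_ && _); rewrite finset.setDUl finset.setDv finset.set0U.
    exact/finset.setDidPl/eqP.
  have dJI : [disjoint J & I] by move: JSI; rewrite finset.subsetD => /andP[].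
  rewrite (finset.setDUl I J I) finset.setDv finset.set0U (finset.setDidPl dJI).
  rewrite -finset.setDDl.
  have -> : inversions I (S :\: I) = (inversions I J + inversions I (S :\: I :\: J))%N.
    rewrite -inversionsUr.
      congr inversions; apply/setP => x; rewrite !inE.
      move/fintype.subsetP: JSI => /(_ x); rewrite !inE.
      by case: (x \in J) => //= /(_ isT).
    by rewrite -finset.setI_eq0 finset.setIDA finset.setDIl finset.setDv finset.set0I.
  rewrite inversionsUl 1?disjoint_sym //.
  by rewrite !exprD; ring.
rewrite (exchange_big_dep (fun K : {set 'I_m} => K \subset S)) /=; last by move=> I K _ /andP[].
apply: eq_bigr => K KS; rewrite ffunE mulr_sumr mulr_suml.
apply: eq_big => [I|I /andP[IS /andP[IK _]]].
  by rewrite KS andbT; case: (boolP (I \subset K)) => IK; rewrite ?andbF //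
     (fintype.subset_trans IK KS).
by rewrite exprD; ring.
Qed.

Lemma inversions0l I : inversions finset.set0 I = 0%N.
Proof. by rewrite /inversions big_set0. Qed.

Lemma inversions0r I : inversions I finset.set0 = 0%N.
Proof. by rewrite /inversions big1 // => i _; rewrite big_set0. Qed.

Lemma grassmann_mul1r : left_id grassmann_one grassmann_mul.
Proof.
move=> a; apply/ffunP => S; rewrite !ffunE (bigD1 finset.set0) ?finset.sub0set //=.
rewrite big1 => [|I /andP[_ /negPf I0]]; last by rewrite ffunE I0 mulr0 mul0r.
by rewrite ffunE eqxx finset.setD0 inversions0l expr0 !mul1r addr0.
Qed.

Lemma grassmann_mulr1 : right_id grassmann_one grassmann_mul.
Proof.
move=> a; apply/ffunP => S; rewrite !ffunE (bigD1 S) //=.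
rewrite big1 => [|I /andP[IS IneqS]].
  by rewrite ffunE finset.setDv eqxx inversions0r expr0 mul1r mulr1 addr0.
rewrite ffunE finset.setD_eq0; case: (boolP (S \subset I)) => [SI|]; last by rewrite mulr0.
by move: IneqS; rewrite finset.eqEsubset IS SI.
Qed.

Lemma grassmann_mulDl : left_distributive grassmann_mul +%R.
Proof.
move=> a b c; apply/ffunP => S; rewrite !ffunE -big_split; apply: eq_bigr => I _ /=.
by rewrite ffunE mulrDr mulrDl.
Qed.

Lemma grassmann_mulDr : right_distributive grassmann_mul +%R.
Proof.
move=> a b c; apply/ffunP => S; rewrite !ffunE -big_split; apply: eq_bigr => I _ /=.
by rewrite ffunE mulrDr.
Qed.

HB.instance Definition _ := GRing.Zmodule_isPzRing.Build (grassmann m A)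
  grassmann_mulA grassmann_mul1r grassmann_mulr1 grassmann_mulDl grassmann_mulDr.

End GrassmannRing.

Section GrassmannParity.
Variables (m : nat) (A : comPzRingType).
Implicit Types a b : grassmann m A.

Lemma grassmannME a b S : (a * b) S = \sum_(I : {set 'I_m} | I \subset S)
   (-1) ^+ inversions I (S :\: I) * a I * b (S :\: I).
Proof. by rewrite [LHS]ffunE. Qed.

Lemma grassmann1E S : (1 : grassmann m A) S = (S == finset.set0)%:R.
Proof. by rewrite [LHS]ffunE. Qed.

Lemma grassmannDE a b S : (a + b) S = a S + b S.
Proof. by rewrite [LHS]ffunE. Qed.

Lemma grassmannNE a S : (- a) S = - a S.
Proof. by rewrite [LHS]ffunE. Qed.

Lemma grassmann0E S : (0 : grassmann m A) S = 0.
Proof. by rewrite [LHS]ffunE. Qed.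

(* p = false gives the even part, p = true the odd part. *)
Definition grassmann_parity (p : bool) : {pred grassmann m A} :=
  fun a => [forall I : {set 'I_m}, (odd #|I| != p) ==> (a I == 0)].

Lemma grassmann_parityP p a :
  reflect (forall I : {set 'I_m}, odd #|I| != p -> a I = 0)
          (a \in grassmann_parity p).
Proof. by apply: (iffP forallP) => h I; [move/implyP: (h I) => /[apply] /eqP | apply/implyP => /h ->]. Qed.

Lemma grassmann_parity_zmod p : zmod_closed (grassmann_parity p).
Proof.
split=> [|a b /grassmann_parityP ha /grassmann_parityP hb]; apply/grassmann_parityP => I Ip.
  by rewrite grassmann0E.
by rewrite grassmannDE grassmannNE ha // hb // subr0.
Qed.

Lemma grassmann_parityD a : exists a0 a1 : grassmann m A,
  [/\ a0 \in grassmann_parity false, a1 \in grassmann_parity true & a = a0 + a1].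
Proof.
exists [ffun S : {set 'I_m} => if odd #|S| then 0 else a S].
exists [ffun S : {set 'I_m} => if odd #|S| then a S else 0].
split; first by apply/grassmann_parityP => I; rewrite ffunE; case: odd.
  by apply/grassmann_parityP => I; rewrite ffunE; case: odd.
by apply/ffunP => I; rewrite !ffunE; case: odd; rewrite ?addr0 ?add0r.
Qed.

Lemma grassmann_parity0 a :
  a \in grassmann_parity false -> a \in grassmann_parity true -> a = 0.
Proof.
move=> /grassmann_parityP h0 /grassmann_parityP h1; apply/ffunP => I.
by rewrite [RHS]ffunE; case: (boolP (odd #|I|)) => oI; [apply: h0; rewrite oI | apply: h1; rewrite (negPf oI)].
Qed.

Lemma grassmann_parity1 : 1 \in grassmann_parity false.
Proof.
apply/grassmann_parityP => I; rewrite grassmann1E.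
by have [->|//] := eqVneq I finset.set0; rewrite cards0.
Qed.

Lemma grassmann_parityM p q a b :
  a \in grassmann_parity p -> b \in grassmann_parity q ->
  a * b \in grassmann_parity (p (+) q).
Proof.
move=> /grassmann_parityP ha /grassmann_parityP hb; apply/grassmann_parityP => S oS.
rewrite grassmannME big1 // => I IS.
have oE : odd #|S| = odd #|I| (+) odd #|S :\: I|.
  by rewrite -oddD -(cardsID I S) (finset.setIidPr IS).
have [oI|/ha ->] := eqVneq (odd #|I|) p; last by rewrite mulr0 mul0r.
rewrite hb ?mulr0 //; apply: contra oS; rewrite oE oI => /eqP ->; exact: eqxx.
Qed.

Lemma grassmann_supercomm p q a b :
  a \in grassmann_parity p -> b \in grassmann_parity q ->
  a * b = (-1) ^+ (p && q) * (b * a).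
Proof.
move=> /grassmann_parityP ha /grassmann_parityP hb; apply/ffunP => S.
have -> : ((-1) ^+ (p && q) * (b * a)) S = (-1) ^+ (p && q) * (b * a) S.
  by case: (p && q); rewrite ?expr0 ?expr1 ?mul1r ?mulN1r ?grassmannNE.
rewrite !grassmannME mulr_sumr.
rewrite [RHS](reindex_onto (fun I => S :\: I) (fun I => S :\: I)) /=; last first.
  by move=> I IS; rewrite finset.setDDr finset.setDv finset.set0U; exact/finset.setIidPr.
apply: eq_big => [I|I IS].
  rewrite finset.subsetDl finset.setDDr finset.setDv finset.set0U /=.
  exact/finset.setIidPr/eqP.
have SDI : S :\: (S :\: I) = I.
  by rewrite finset.setDDr finset.setDv finset.set0U; exact/finset.setIidPr.
rewrite SDI.
have [oI|/ha ->] := eqVneq (odd #|I|) p; last by rewrite !(mulr0, mul0r).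
have [oSI|/hb ->] := eqVneq (odd #|S :\: I|) q; last by rewrite !(mulr0, mul0r).
have dI : [disjoint I & S :\: I].
  by rewrite -finset.setI_eq0 finset.setIDA finset.setDIl finset.setDv finset.set0I.
have -> : (-1) ^+ (p && q) = (-1) ^+ (inversions I (S :\: I) + inversions (S :\: I) I) :> A.
  by rewrite inversionsC // -oI -oSI -oddM signr_odd.
rewrite exprD; set u := (-1) ^+ inversions I _; set v := (-1) ^+ _.
have vv : v * v = 1 by rewrite -expr2 sqrr_sign.
by rewrite -[LHS]mulr1 -vv; ring.
Qed.
End GrassmannParity.

Section GrassmannMap.
Variables (m : nat).

Definition grassmann_map (A B : comPzRingType) (f : {rmorphism A -> B})
  (a : grassmann m A) : grassmann m B := [ffun S : {set 'I_m} => f (a S)].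

Definition grassmann_const (A : comPzRingType) (c : A) : grassmann m A :=
  [ffun S : {set 'I_m} => if S == finset.set0 then c else 0].

Variables (A B : comPzRingType) (f : {rmorphism A -> B}).

Lemma grassmann_map_zmod : zmod_morphism (grassmann_map f).
Proof. by move=> a b; apply/ffunP => S; rewrite !ffunE rmorphB. Qed.

Lemma grassmann_map_monoid : monoid_morphism (grassmann_map f).
Proof.
split=> [|a b]; apply/ffunP => S; rewrite ffunE.
  by rewrite !grassmann1E rmorph_nat.
rewrite !grassmannME rmorph_sum; apply: eq_bigr => I _.
by rewrite !ffunE !rmorphM rmorph_sign.
Qed.

HB.instance Definition _ := GRing.isZmodMorphism.Build _ _ (grassmann_map f)
  grassmann_map_zmod.
HB.instance Definition _ := GRing.isMonoidMorphism.Build _ _ (grassmann_map f)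
  grassmann_map_monoid.

Lemma grassmann_map_const c :
  grassmann_map f (grassmann_const c) = grassmann_const (f c).
Proof. by apply/ffunP => S; rewrite !ffunE; case: ifP; rewrite ?rmorph0. Qed.

Lemma grassmann_map_parity p a : a \in grassmann_parity p ->
  grassmann_map f a \in grassmann_parity p.
Proof.
move=> /grassmann_parityP ha; apply/grassmann_parityP => I /ha aI.
by rewrite ffunE aI rmorph0.
Qed.

Lemma grassmann_const_zmod : zmod_morphism (@grassmann_const A).
Proof. by move=> a b; apply/ffunP => S; rewrite !ffunE; case: ifP; rewrite ?subr0. Qed.

Lemma grassmann_const_monoid : monoid_morphism (@grassmann_const A).
Proof.
split=> [|a b]; apply/ffunP => S.
  by rewrite grassmann1E ffunE; case: eqP.
rewrite grassmannME ffunE (bigD1 finset.set0) ?finset.sub0set //= big1 => [|I /andP[_ /negPf I0]].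
  rewrite !ffunE eqxx finset.setD0 inversions0l expr0 mul1r addr0.
  by case: ifP; rewrite ?mulr0.
by rewrite ffunE I0 mulr0 mul0r.
Qed.

HB.instance Definition _ := GRing.isZmodMorphism.Build _ _ (@grassmann_const A)
  grassmann_const_zmod.
HB.instance Definition _ := GRing.isMonoidMorphism.Build _ _ (@grassmann_const A)
  grassmann_const_monoid.

Lemma grassmann_const_even (c : A) : grassmann_const c \in grassmann_parity false.
Proof.
apply/grassmann_parityP => I; rewrite ffunE.
by have [->|//] := eqVneq I finset.set0; rewrite cards0.
Qed.

End GrassmannMap.

(* Parity false is the even part and parity true the odd part.  The ring may
   be zero (sections over the empty set), so this is not an [algType]. *)
Record superalgebra (F : fieldType) := SuperAlgebra {
  sa_ring :> pzRingType;
  sa_scal : {rmorphism F -> sa_ring};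
  sa_parity : bool -> {pred sa_ring};
  sa_parity_zmod : forall p, zmod_closed (sa_parity p);
  sa_parityD : forall x, exists x0 x1,
    [/\ x0 \in sa_parity false, x1 \in sa_parity true & x = x0 + x1];
  sa_parity0 : forall x, x \in sa_parity false -> x \in sa_parity true -> x = 0;
  sa_scal_even : forall c, sa_scal c \in sa_parity false;
  sa_parityM : forall p q x y, x \in sa_parity p -> y \in sa_parity q ->
    x * y \in sa_parity (p (+) q);
  sa_supercomm : forall p q x y, x \in sa_parity p -> y \in sa_parity q ->
    x * y = (-1) ^+ (p && q) * (y * x)
}.

Arguments sa_scal {F} A : rename.
Arguments sa_parity {F} A p : rename.

Record sa_hom (F : fieldType) (A B : superalgebra F) := SaHom {
  sa_fun :> {rmorphism A -> B};
  sa_fun_scal : forall c, sa_fun (sa_scal A c) = sa_scal B c;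
  sa_fun_parity : forall p x, x \in sa_parity A p -> sa_fun x \in sa_parity B p
}.

Section GrassmannSuper.
Variables (F : fieldType) (m : nat).

Program Definition grassmann_super (A : comPzRingType) (scal : {rmorphism F -> A})
    : superalgebra F :=
  @SuperAlgebra F (grassmann m A) (@grassmann_const m A \o scal)
    (@grassmann_parity m A) _ _ _ _ _ _.
Next Obligation. by move=> *; exact: grassmann_parity_zmod. Qed.
Next Obligation. by move=> *; exact: grassmann_parityD. Qed.
Next Obligation. by move=> *; exact: grassmann_parity0. Qed.
Next Obligation. by move=> *; exact: grassmann_const_even. Qed.
Next Obligation. by move=> *; exact: grassmann_parityM. Qed.
Next Obligation. by move=> *; exact: grassmann_supercomm. Qed.

End GrassmannSuper.

Section EvenPart.
Variables (F : fieldType) (A : superalgebra F).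

HB.instance Definition _ p := GRing.isZmodClosed.Build A (sa_parity A p)
  (sa_parity_zmod A p).

Definition even_part : Type := {x : A | x \in sa_parity A false}.

HB.instance Definition _ := [isSub of even_part for @sval A _].
HB.instance Definition _ := [Choice of even_part by <:].
HB.instance Definition _ := [SubChoice_isSubZmodule of even_part by <:].

Lemma even_comm (x y : A) : x \in sa_parity A false -> y \in sa_parity A false ->
  x * y = y * x.
Proof. by move=> ex ey; rewrite (sa_supercomm ex ey) expr0 mul1r. Qed.

Lemma even1 : 1 \in sa_parity A false.
Proof. by rewrite -(rmorph1 (sa_scal A)) sa_scal_even. Qed.

Definition invertible (x : A) : Prop := exists y, x * y = 1 /\ y * x = 1.

Lemma even_inverse (x y : A) : x \in sa_parity A false ->
  x * y = 1 -> y * x = 1 -> y \in sa_parity A false.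
Proof.
move=> ex xy yx; have [y0 [y1 [e0 o1 yE]]] := sa_parityD y.
have xy1 : x * y1 = 0.
  apply: sa_parity0; last by have := sa_parityM ex o1.
  have -> : x * y1 = 1 - x * y0 by rewrite -xy yE mulrDr addrAC subrr add0r.
  by rewrite rpredB ?even1 //; have := sa_parityM ex e0.
suff -> : y = y0 by [].
by rewrite yE -[y1]mul1r -yx -mulrA xy1 mulr0 addr0.
Qed.

Definition even_unit_pred : {pred A} :=
  fun x => (x \in sa_parity A false) && `[< invertible x >].

(* The group of even invertible elements; its multiplicative group law is
   presented as a [zmodType]: + is the product, 0 is 1 and - is inversion. *)
Definition even_unit : Type := {x : A | x \in even_unit_pred}.

HB.instance Definition _ := [isSub of even_unit for @sval A _].
HB.instance Definition _ := [Choice of even_unit by <:].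

Lemma even_unitP (x : A) :
  reflect (x \in sa_parity A false /\ invertible x) (x \in even_unit_pred).
Proof. by apply: (iffP andP) => -[e /asboolP u]. Qed.

Lemma even_unit_one_subproof : 1 \in even_unit_pred.
Proof. by apply/even_unitP; split; [exact: even1 | exists 1; rewrite mulr1]. Qed.

Lemma even_unit_mul_subproof (u v : even_unit) : val u * val v \in even_unit_pred.
Proof.
case: u v => [u /= /even_unitP[eu [u' [uu' u'u]]]] [v /= /even_unitP[ev [v' [vv' v'v]]]].
apply/even_unitP; split; first by have := sa_parityM eu ev.
exists (v' * u'); split.
  by rewrite mulrA -(mulrA u) vv' mulr1.
by rewrite mulrA -(mulrA v') u'u mulr1.
Qed.

Lemma even_unit_inv_subproof (u : even_unit) :
  {v : A | v \in even_unit_pred & v * val u = 1}.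
Proof.
case: u => [u /= /even_unitP[eu /cid[u' [uu' u'u]]]].
exists u' => //; apply/even_unitP; split; first exact: (even_inverse eu).
by exists u.
Qed.

Definition even_unit_one : even_unit := Sub 1 even_unit_one_subproof.
Definition even_unit_mul u v : even_unit :=
  Sub (val u * val v) (even_unit_mul_subproof u v).
Definition even_unit_inv u : even_unit :=
  let: exist2 v hv _ := even_unit_inv_subproof u in Sub v hv.

Lemma even_unit_mulA : associative even_unit_mul.
Proof. by move=> u v w; apply: val_inj; rewrite /= mulrA. Qed.

Lemma even_unit_mulC : commutative even_unit_mul.
Proof.
move=> u v; apply: val_inj => /=.
by case/even_unitP: (valP u) => eu _; case/even_unitP: (valP v) => ev _; exact: even_comm.
Qed.

Lemma even_unit_mul1 : left_id even_unit_one even_unit_mul.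
Proof. by move=> u; apply: val_inj; rewrite /= mul1r. Qed.

Lemma even_unit_mulV : left_inverse even_unit_one even_unit_inv even_unit_mul.
Proof.
move=> u; apply: val_inj; rewrite /even_unit_inv /=.
by case: even_unit_inv_subproof.
Qed.

HB.instance Definition _ := GRing.isZmodule.Build even_unit
  even_unit_mulA even_unit_mulC even_unit_mul1 even_unit_mulV.

End EvenPart.

Local Open Scope classical_set_scope.
Local Open Scope ring_scope.

Record opens (X : topologicalType) := Opens {
  opens_set :> set X;
  opens_open : open opens_set
}.

Definition sheaf_axiom (X : topologicalType) (P : opens X -> Type)
    (res : forall U V : opens X, V `<=` U -> P U -> P V) : Prop :=
  forall (I : Type) (U : opens X) (W : I -> opens X) (WU : forall i, W i `<=` U),
    U `<=` \bigcup_i W i ->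
  forall s : forall i, P (W i),
    (forall i j (V : opens X) (Vi : V `<=` W i) (Vj : V `<=` W j),
       res _ _ Vi (s i) = res _ _ Vj (s j)) ->
  exists! t : P U, forall i, res _ _ (WU i) t = s i.

Record super_presheaf (F : fieldType) (X : topologicalType) := SuperPresheaf {
  sp_obj :> opens X -> superalgebra F;
  sp_res : forall U V : opens X, V `<=` U -> sa_hom (sp_obj U) (sp_obj V);
  sp_res_id : forall (U : opens X) (UU : U `<=` U) s, sp_res UU s = s;
  sp_res_comp : forall (U V W : opens X) (VU : V `<=` U) (WV : W `<=` V)
    (WU : W `<=` U) s, sp_res WV (sp_res VU s) = sp_res WU s
}.

Arguments sp_res {F X} O {U V} _ : rename.

Definition is_super_sheaf (F : fieldType) (X : topologicalType)
    (O : super_presheaf F X) : Prop :=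
  sheaf_axiom (fun U V (VU : V `<=` U) (s : O U) => sp_res O VU s).

Section LocallyRinged.
Variables (F : fieldType) (X : topologicalType) (O : super_presheaf F X).

Definition germ_invertible (x : X) (U : opens X) (s : O U) : Prop :=
  exists (V : opens X) (VU : V `<=` U), opens_set V x /\ invertible (sp_res O VU s).

(* Every stalk is a local ring: 1 <> 0 and the non-units are closed under
   addition (two germs are represented over a common neighbourhood). *)
Definition locally_ringed : Prop := forall x : X,
  (forall U : opens X, opens_set U x -> (1 : O U) <> 0) /\
  (forall (U : opens X) (s t : O U), opens_set U x ->
     germ_invertible x (s + t) -> germ_invertible x s \/ germ_invertible x t).

End LocallyRinged.

Record ab_sheaf (X : topologicalType) := AbSheaf {
  ab_obj :> opens X -> zmodType;
  ab_res : forall U V : opens X, V `<=` U -> {additive ab_obj U -> ab_obj V};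
  ab_res_id : forall (U : opens X) (UU : U `<=` U) s, ab_res UU s = s;
  ab_res_comp : forall (U V W : opens X) (VU : V `<=` U) (WV : W `<=` V)
    (WU : W `<=` U) s, ab_res WV (ab_res VU s) = ab_res WU s;
  ab_sheafP : sheaf_axiom (fun U V (VU : V `<=` U) (s : ab_obj U) => ab_res VU s)
}.

Arguments ab_res {X} G {U V} _ : rename.

Record ab_hom (X : topologicalType) (G H : ab_sheaf X) := AbHom {
  ab_fun :> forall U : opens X, {additive G U -> H U};
  ab_fun_res : forall (U V : opens X) (VU : V `<=` U) (s : G U),
    ab_fun V (ab_res G VU s) = ab_res H VU (ab_fun U s)
}.

(* Surjectivity as a map of sheaves, i.e. up to restriction to a neighbourhood. *)
Definition ab_surjective (X : topologicalType) (G H : ab_sheaf X)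
    (f : ab_hom G H) : Prop :=
  forall (U : opens X) (t : H U) (x : X), opens_set U x ->
  exists (V : opens X) (VU : V `<=` U),
    opens_set V x /\ exists s : G V, f V s = ab_res H VU t.

(* R[i] as a numClosedFieldType, which gives it its normed topology. *)
Definition cplx (R : realType) : numClosedFieldType := complex R.

Section HolomorphicFunctions.
Variables (R : realType) (n : nat).
Local Notation C := (cplx R).

(* For V open: complex Fréchet differentiability at every point of V, the
   function being extended arbitrarily outside V. *)
Definition holomorphic (V : set 'rV[C]_n) (f : V -> C) : Prop :=
  forall z : V, exists g : 'rV[C]_n -> C,
    (forall w : V, g (val w) = f w) /\ differentiable g (val z).

Definition holo_pred (V : set 'rV[C]_n) : {pred V -> C} :=
  fun f => `[< holomorphic f >].

Lemma holo_subring V : subring_closed (@holo_pred V).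
Proof.
split.
- apply/asboolP => z; exists (cst 1); split=> //; exact: differentiable_cst.
- move=> f g /asboolP hf /asboolP hg; apply/asboolP => z.
  have [f' [ff' df]] := hf z; have [g' [gg' dg]] := hg z.
  exists (f' - g'); split; last exact: differentiableB.
  by move=> w; rewrite !fctE ff' gg'.
- move=> f g /asboolP hf /asboolP hg; apply/asboolP => z.
  have [f' [ff' df]] := hf z; have [g' [gg' dg]] := hg z.
  exists (f' * g'); split; last exact: differentiableM.
  by move=> w; rewrite !fctE ff' gg'.
Qed.

HB.instance Definition _ V := GRing.isSubringClosed.Build _ (@holo_pred V)
  (holo_subring V).

Definition holo (V : set 'rV[C]_n) : Type := {f : V -> C | f \in @holo_pred V}.

HB.instance Definition _ V := [isSub of holo V for @sval (V -> C) _].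
HB.instance Definition _ V := [Choice of holo V by <:].
HB.instance Definition _ V := GRing.SubChoice_isSubComPzRing.Build _ _ (holo V) (subringClosedP _).

End HolomorphicFunctions.

Section SuperDomain.
Variables (R : realType) (n m : nat).
Local Notation C := (cplx R).
Local Notation Cn := 'rV[C]_n.

Definition sub_incl (T : Type) (U V : set T) (VU : V `<=` U) (z : V) : U :=
  exist _ (val z) (mem_set (VU _ (set_mem (valP z)))).

Lemma holo_res_subproof (U V : set Cn) (VU : V `<=` U) (f : holo U) :
  (val f \o sub_incl VU) \in @holo_pred R n V.
Proof.
apply/asboolP => z; have /asboolP/(_ (sub_incl VU z))[g [gf dg]] := valP f.
by exists g; split=> // w; rewrite -[val w]/(val (sub_incl VU w)) gf.
Qed.

Definition holo_res (U V : set Cn) (VU : V `<=` U) (f : holo U) : holo V :=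
  Sub (val f \o sub_incl VU) (holo_res_subproof VU f).

Lemma holo_res_zmod U V (VU : V `<=` U) : zmod_morphism (@holo_res U V VU).
Proof. by move=> f g; apply: val_inj. Qed.

Lemma holo_res_monoid U V (VU : V `<=` U) : monoid_morphism (@holo_res U V VU).
Proof. by split=> [|f g]; apply: val_inj. Qed.

HB.instance Definition _ U V (VU : V `<=` U) :=
  GRing.isZmodMorphism.Build _ _ (@holo_res U V VU) (holo_res_zmod VU).
HB.instance Definition _ U V (VU : V `<=` U) :=
  GRing.isMonoidMorphism.Build _ _ (@holo_res U V VU) (holo_res_monoid VU).

Lemma holo_const_subproof (V : set Cn) (c : C) : (fun=> c) \in @holo_pred R n V.
Proof. by apply/asboolP => z; exists (cst c); split=> //; exact: differentiable_cst. Qed.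

Definition holo_const (V : set Cn) (c : C) : holo V :=
  Sub (fun=> c) (holo_const_subproof V c).

Lemma holo_const_zmod V : zmod_morphism (@holo_const V).
Proof. by move=> a b; apply: val_inj. Qed.

Lemma holo_const_monoid V : monoid_morphism (@holo_const V).
Proof. by split=> [|a b]; apply: val_inj. Qed.

HB.instance Definition _ V :=
  GRing.isZmodMorphism.Build _ _ (@holo_const V) (@holo_const_zmod V).
HB.instance Definition _ V :=
  GRing.isMonoidMorphism.Build _ _ (@holo_const V) (@holo_const_monoid V).

Definition superdomain_obj (V : set Cn) : superalgebra C :=
  grassmann_super m (@holo_const V).

Lemma superdomain_res_scal U V (VU : V `<=` U) (c : C) :
  grassmann_map (@holo_res U V VU) (sa_scal (superdomain_obj U) c) =
  sa_scal (superdomain_obj V) c.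
Proof.
rewrite [LHS]grassmann_map_const; congr grassmann_const.
exact: val_inj.
Qed.

Definition superdomain_res U V (VU : V `<=` U) :
    sa_hom (superdomain_obj U) (superdomain_obj V) :=
  @SaHom _ (superdomain_obj U) (superdomain_obj V)
    (@grassmann_map m _ _ (@holo_res U V VU)) (superdomain_res_scal VU)
    (@grassmann_map_parity m _ _ (@holo_res U V VU)).

(* The structure sheaf of C^{n|m}: sections over V are the elements
   \sum_I f_I ξ_I of O(V) ⊗ ⋀[ξ_0, …, ξ_(m-1)]. *)
Program Definition superdomain : super_presheaf C Cn :=
  @SuperPresheaf C Cn superdomain_obj (fun U V => @superdomain_res U V) _ _.
Next Obligation.
move=> U UU s; apply/ffunP => I; rewrite ffunE; apply: val_inj.
by apply/funext => z /=; congr (val (s I) _); apply: val_inj.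
Qed.
Next Obligation.
move=> U V W VU WV WU s; apply/ffunP => I; rewrite !ffunE; apply: val_inj.
by apply/funext => z /=; congr (val (s I) _); apply: val_inj.
Qed.

Definition coef_at (V : opens Cn) (a : superdomain V) (I : {set 'I_m}) (z : V) : C :=
  val ((a : grassmann m (holo V)) I) z.

End SuperDomain.

Section Charts.
Variables (R : realType) (n m : nat) (X : topologicalType).
Local Notation C := (cplx R).
Local Notation Cn := 'rV[C]_n.
Variable O : super_presheaf C X.

Lemma open_preimage (U : opens X) (f : X -> Cn) :
  {in U : set X, continuous f} -> forall W : opens Cn, open (U `&` f @^-1` W).
Proof.
move=> cf W; rewrite openE => x [Ux Wx]; rewrite /interior.
apply: filterI; first by apply: open_nbhs_nbhs; split=> //; exact: opens_open.
by apply: (cf x (mem_set Ux)); apply: open_nbhs_nbhs; split=> //; exact: opens_open.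
Qed.

Definition preimage_opens (U : opens X) (f : X -> Cn)
    (cf : {in U : set X, continuous f}) (W : opens Cn) : opens X :=
  Opens (open_preimage cf W).

(* An isomorphism of ringed spaces between the restriction of (X, O) to an open
   set and an open subspace of C^{n|m}: a homeomorphism f : U -> V together with
   an isomorphism O_V ≅ f_* (O|_U) of sheaves of superalgebras. *)
Record chart := Chart {
  ch_dom : opens X;
  ch_cod : opens Cn;
  ch_map : X -> Cn;
  ch_bij : set_bij ch_dom ch_cod ch_map;
  ch_cont : {in ch_dom : set X, continuous ch_map};
  ch_open : forall W : opens X, W `<=` ch_dom -> open (ch_map @` W);
  ch_iso : forall W : opens Cn, W `<=` ch_cod -> sa_hom (O (preimage_opens ch_cont W)) (superdomain R n m W);
  ch_iso_bij : forall (W : opens Cn) (WV : W `<=` ch_cod), bijective (ch_iso WV);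
  ch_iso_res : forall (W W' : opens Cn) (WV : W `<=` ch_cod) (W'V : W' `<=` ch_cod)
    (W'W : W' `<=` W) (pW'W : preimage_opens ch_cont W' `<=` preimage_opens ch_cont W) s,
    ch_iso W'V (sp_res O pW'W s) =
    sp_res (superdomain R n m) W'W (ch_iso WV s)
}.

End Charts.

(* No separation or countability axiom is imposed on the underlying space. *)
Record supermanifold (R : realType) (n m : nat) := Supermanifold {
  sm_top :> topologicalType;
  sm_sheaf : super_presheaf (cplx R) sm_top;
  sm_sheafP : is_super_sheaf sm_sheaf;
  sm_local : locally_ringed sm_sheaf;
  sm_charts : forall x : sm_top,
    exists c : chart n m sm_sheaf, opens_set (ch_dom c) x
}.

Section SubSheaves.
Variables (F : fieldType) (X : topologicalType) (O : super_presheaf F X).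
Hypothesis Osheaf : is_super_sheaf O.

Lemma even_res_subproof (U V : opens X) (VU : V `<=` U) (s : even_part (O U)) :
  sp_res O VU (val s) \in sa_parity (O V) false.
Proof. exact: sa_fun_parity (valP s). Qed.

Definition even_res (U V : opens X) (VU : V `<=` U) (s : even_part (O U)) :
  even_part (O V) := Sub (sp_res O VU (val s)) (even_res_subproof VU s).

Lemma even_res_zmod (U V : opens X) (VU : V `<=` U) : zmod_morphism (@even_res U V VU).
Proof. by move=> s t; apply: val_inj; rewrite /= rmorphB. Qed.

HB.instance Definition _ (U V : opens X) (VU : V `<=` U) :=
  GRing.isZmodMorphism.Build _ _ (@even_res U V VU) (even_res_zmod VU).

Lemma even_unit_res_subproof (U V : opens X) (VU : V `<=` U) (s : even_unit (O U)) :
  sp_res O VU (val s) \in @even_unit_pred F (O V).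
Proof.
have /even_unitP[es [t [st ts]]] := valP s.
apply/even_unitP; split; first exact: sa_fun_parity.
by exists (sp_res O VU t); rewrite -!rmorphM st ts rmorph1.
Qed.

Definition even_unit_res (U V : opens X) (VU : V `<=` U) (s : even_unit (O U)) :
  even_unit (O V) := Sub (sp_res O VU (val s)) (even_unit_res_subproof VU s).

Lemma even_unit_res_nmod (U V : opens X) (VU : V `<=` U) : nmod_morphism (@even_unit_res U V VU).
Proof. by split=> [|s t]; apply: val_inj; rewrite /= ?rmorph1 ?rmorphM. Qed.

HB.instance Definition _ (U V : opens X) (VU : V `<=` U) :=
  GRing.isNmodMorphism.Build _ _ (@even_unit_res U V VU) (even_unit_res_nmod VU).

Section Glue.
Variables (I : Type) (U : opens X) (W : I -> opens X) (WU : forall i, W i `<=` U).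
Hypothesis cover : U `<=` \bigcup_i W i.

Lemma super_sheaf_sep (s t : O U) :
  (forall i, sp_res O (@WU i) s = sp_res O (@WU i) t) -> s = t.
Proof.
move=> st; have [|r [_ rU]] := @Osheaf I U W WU cover (fun i => sp_res O (@WU i) s).
  move=> i j V Vi Vj; have VU := subset_trans Vi (@WU i).
  by rewrite !(sp_res_comp _ _ VU).
by rewrite -(rU s (fun=> erefl)) -(rU t (fun i => esym (st i))).
Qed.

Lemma even_local (s : O U) : (forall i, sp_res O (@WU i) s \in sa_parity _ false) ->
  s \in sa_parity _ false.
Proof.
move=> es; have [s0 [s1 [e0 o1 sE]]] := sa_parityD s.
suff s10 : s1 = 0 by rewrite sE s10 addr0.
apply: super_sheaf_sep => i; rewrite rmorph0; apply: sa_parity0; last first.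
  exact: sa_fun_parity.
have -> : s1 = s - s0 by rewrite sE addrAC subrr add0r.
have ri : sp_res O (@WU i) s0 \in sa_parity _ false by exact: sa_fun_parity.
by rewrite rmorphB; exact: rpredB (es i) ri.
Qed.

Lemma invertible_local (s : O U) : (forall i, invertible (sp_res O (@WU i) s)) ->
  invertible s.
Proof.
move=> us; have inv_uniq (A : superalgebra F) (x y y' : A) :
    x * y = 1 -> y' * x = 1 -> y = y'.
  by move=> xy y'x; rewrite -[y]mul1r -y'x -mulrA xy mulr1.
pose t i := sval (cid (us i)).
have tl i : sp_res O (@WU i) s * t i = 1 by rewrite /t; case: cid => ? [].
have tr i : t i * sp_res O (@WU i) s = 1 by rewrite /t; case: cid => ? [].
have [|r [rt _]] := @Osheaf I U W WU cover t.
  move=> i j V Vi Vj; have VU := subset_trans Vi (@WU i).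
  apply: (inv_uniq _ (sp_res O VU s)).
    by rewrite -(sp_res_comp (@WU i) Vi) -rmorphM tl rmorph1.
  by rewrite -(sp_res_comp (@WU j) Vj) -rmorphM tr rmorph1.
by exists r; split; apply: super_sheaf_sep => i; rewrite rmorphM rt rmorph1 ?tl ?tr.
Qed.

End Glue.

Lemma even_sheaf_axiom :
  sheaf_axiom (fun U V (VU : V `<=` U) (s : even_part (O U)) => even_res VU s).
Proof.
move=> I U W WU cover s compat.
have [|t [ts tU]] := @Osheaf I U W WU cover (fun i => val (s i)).
  by move=> i j V Vi Vj; exact: (congr1 (fun u : even_part _ => val u) (compat i j V Vi Vj)).
have et : t \in sa_parity _ false.
  by apply: (even_local cover) => i; rewrite ts; exact: valP.
exists (exist _ t et); split; first by move=> i; apply: val_inj; exact: ts.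
by move=> t' t's; apply: val_inj; apply: tU => i; rewrite -t's.
Qed.

Lemma even_unit_sheaf_axiom :
  sheaf_axiom (fun U V (VU : V `<=` U) (s : even_unit (O U)) => even_unit_res VU s).
Proof.
move=> I U W WU cover s compat.
have [|t [ts tU]] := @Osheaf I U W WU cover (fun i => val (s i)).
  by move=> i j V Vi Vj; exact: (congr1 (fun u : even_unit _ => val u) (compat i j V Vi Vj)).
have et : t \in @even_unit_pred _ _.
  apply/even_unitP; split.
    by apply: (even_local cover) => i; rewrite ts; case/even_unitP: (valP (s i)).
  by apply: (invertible_local cover) => i; rewrite ts; case/even_unitP: (valP (s i)).
exists (exist _ t et); split; first by move=> i; apply: val_inj; exact: ts.
by move=> t' t's; apply: val_inj; apply: tU => i; rewrite -t's.
Qed.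

Program Definition even_sheaf_of : ab_sheaf X :=
  @AbSheaf X (fun U => even_part (O U)) (fun U V VU => @even_res U V VU) _ _
    even_sheaf_axiom.
Next Obligation. by move=> U UU s; apply: val_inj; exact: sp_res_id. Qed.
Next Obligation. by move=> *; apply: val_inj; exact: sp_res_comp. Qed.

Program Definition even_unit_sheaf_of : ab_sheaf X :=
  @AbSheaf X (fun U => even_unit (O U)) (fun U V VU => @even_unit_res U V VU) _ _
    even_unit_sheaf_axiom.
Next Obligation. by move=> U UU s; apply: val_inj; exact: sp_res_id. Qed.
Next Obligation. by move=> *; apply: val_inj; exact: sp_res_comp. Qed.

End SubSheaves.

Section IntSheaf.
Variable X : topologicalType.

Definition locally_constant (U : opens X) (f : U -> int) : Prop :=
  forall x : U, \forall y \near val x, forall Uy : y \in (U : set X),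
    f (exist _ y Uy) = f x.

Definition lcst_pred (U : opens X) : {pred U -> int} :=
  fun f => `[< locally_constant f >].

Lemma lcst_zmod U : zmod_closed (@lcst_pred U).
Proof.
split; first by apply/asboolP => x; near=> y.
move=> f g /asboolP hf /asboolP hg; apply/asboolP => x.
near=> y => Uy; rewrite !fctE; congr (_ - _).
  by move: Uy; near: y; exact: hf.
by move: Uy; near: y; exact: hg.
Unshelve. all: by end_near. Qed.

HB.instance Definition _ U := GRing.isZmodClosed.Build _ (@lcst_pred U) (lcst_zmod U).

Definition lcst (U : opens X) : Type := {f : U -> int | f \in @lcst_pred U}.

HB.instance Definition _ U := [isSub of lcst U for @sval (U -> int) _].
HB.instance Definition _ U := [Choice of lcst U by <:].
HB.instance Definition _ U := [SubChoice_isSubZmodule of lcst U by <:].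

Lemma lcst_res_subproof (U V : opens X) (VU : V `<=` U) (f : lcst U) :
  (val f \o sub_incl VU) \in @lcst_pred V.
Proof.
have /asboolP hf := valP f; apply/asboolP => x.
apply: filterS (hf (sub_incl VU x)) => y fy Vy /=.
by rewrite -fy; [exact: mem_set (VU _ (set_mem Vy)) | move=> Uy; congr (val f _); apply: val_inj].
Qed.

Definition lcst_res (U V : opens X) (VU : V `<=` U) (f : lcst U) : lcst V :=
  Sub (val f \o sub_incl VU) (lcst_res_subproof VU f).

Lemma lcst_res_zmod (U V : opens X) (VU : V `<=` U) : zmod_morphism (@lcst_res U V VU).
Proof. by move=> f g; apply: val_inj. Qed.

HB.instance Definition _ (U V : opens X) (VU : V `<=` U) :=
  GRing.isZmodMorphism.Build _ _ (@lcst_res U V VU) (lcst_res_zmod VU).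

Lemma lcst_sheaf_axiom :
  sheaf_axiom (fun U V (VU : V `<=` U) (s : lcst U) => lcst_res VU s).
Proof.
move=> I U W WU cover s compat.
have cov (x : U) : {i | val x \in (W i : set X)}.
  by apply: cid; have [i _ Wi] := cover _ (set_mem (valP x)); exists i; exact: mem_set.
pose t (x : U) : int := val (s (sval (cov x))) (exist _ (val x) (svalP (cov x))).
have tE i (x : W i) (Ux : val x \in (U : set X)) : t (exist _ (val x) Ux) = val (s i) x.
  rewrite /t; case: (cov _) => j /= Wjx.
  have oV : open (W i `&` W j) by apply: openI; exact: opens_open.
  have Vx : val x \in W i `&` W j.
    by apply: mem_set; split; [exact: set_mem (valP x) | exact: set_mem Wjx].
  have := compat i j (Opens oV) (@subIsetl _ _ _) (@subIsetr _ _ _).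
  move=> /(congr1 (fun f : lcst (Opens oV) => val f (exist _ (val x) Vx))) /= e.
  transitivity (val (s j) (sub_incl (@subIsetr _ (W i) (W j)) (exist _ (val x) Vx))).
    by congr (val (s j) _); apply: val_inj.
  by apply: etrans (esym e) _; congr (val (s i) _); apply: val_inj.
have lt : t \in @lcst_pred U.
  apply/asboolP => x; have [i Wix] := cov x.
  pose xi : W i := exist (fun y => y \in (W i : set X)) (val x) Wix.
  have /asboolP/(_ xi) /= h := valP (s i).
  have oW : \forall y \near val x, opens_set (W i) y.
    by apply: open_nbhs_nbhs; split; [exact: opens_open | exact: set_mem Wix].
  near=> y => Uy.
  have Wy : y \in (W i : set X) by apply: mem_set; near: y; exact: oW.
  rewrite (tE i (exist (fun y => y \in (W i : set X)) y Wy) Uy).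
  transitivity (val (s i) xi).
    by move: Wy; near: y; exact: h.
  by rewrite -(tE i xi (valP x)); congr t; apply: val_inj.
exists (exist _ t lt); split.
  move=> i; apply: val_inj; apply/funext => x /=; exact: tE.
move=> t' t's; apply: val_inj; apply/funext => x /=.
have [i Wix] := cov x.
pose xi : W i := exist (fun y => y \in (W i : set X)) (val x) Wix.
transitivity (t (exist _ (val x) (valP x))); first by congr t; apply: val_inj.
rewrite (tE i xi (valP x)) -t's /=.
by congr (val t' _); apply: val_inj.
Unshelve. all: by end_near. Qed.

Program Definition int_sheaf : ab_sheaf X :=
  @AbSheaf X lcst (fun U V VU => @lcst_res U V VU) _ _ lcst_sheaf_axiom.
Next Obligation.
by move=> U UU s; apply: val_inj; apply/funext => x; congr (val s _); apply: val_inj.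
Qed.
Next Obligation.
by move=> U V W VU WV WU s; apply: val_inj; apply/funext => x;
  congr (val s _); apply: val_inj.
Qed.

End IntSheaf.

Arguments sm_sheafP {R n m} M : rename.

Section Exponential.
Variables (R : realType) (n m : nat) (M : supermanifold R n m).
Local Notation C := (cplx R).

Definition even_sheaf : ab_sheaf M := even_sheaf_of (sm_sheafP M).
Definition even_unit_sheaf : ab_sheaf M := even_unit_sheaf_of (sm_sheafP M).

Definition exp_psum (F : fieldType) (A : superalgebra F) (x : A) (N : nat) : A :=
  \sum_(k < N) sa_scal A (k`!%:R^-1) * x ^+ k.

(* y = e^x: in every chart, the exponential series of x converges pointwise to y,
   coefficient by coefficient. *)
Definition is_exp (U : opens M) (x y : sm_sheaf M U) : Prop :=
  forall (c : chart n m (sm_sheaf M)) (W : opens 'rV[C]_n) (WV : W `<=` ch_cod c)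
    (WU : preimage_opens (@ch_cont _ _ _ _ _ c) W `<=` U)
    (I : {set 'I_m}) (z : W),
  (fun N => coef_at (exp_psum (ch_iso WV (sp_res (sm_sheaf M) WU x)) N) I z) @ \oo
    --> coef_at (ch_iso WV (sp_res (sm_sheaf M) WU y)) I z.

Definition two_pi_i : C := Complex 0 (2 * pi).

Lemma even_intr (A : superalgebra C) (c : int) : c%:~R \in sa_parity A false.
Proof. exact: rpredMz (even1 A). Qed.

Definition even_int (A : superalgebra C) (c : int) : even_part A :=
  Sub c%:~R (even_intr A c).

Definition is_int_section (U : opens M) (k : int_sheaf M U) (s : even_sheaf U) : Prop :=
  forall (V : opens M) (VU : V `<=` U) (c : int),
    (forall x : U, opens_set V (val x) -> val k x = c) ->
    sp_res (sm_sheaf M) VU (val s) = c%:~R.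

Lemma lcst_nbhd (U : opens M) (k : int_sheaf M U) (x : U) :
  exists V : opens M, [/\ V `<=` U, opens_set V (val x) &
    forall y : U, opens_set V (val y) -> val k y = val k x].
Proof.
have /asboolP/(_ x) h := valP k.
have : nbhs (val x) (opens_set U).
  by apply: open_nbhs_nbhs; split; [exact: opens_open | exact: set_mem (valP x)].
move=> /(filterI h); rewrite nbhsE => -[V [oV Vx] VU].
exists (Opens oV); split=> // [y /VU[]//|y /VU[ky _]].
by rewrite -(ky (valP y)); congr (val k _); apply: val_inj.
Qed.

Lemma int_section_exists (U : opens M) (k : int_sheaf M U) :
  exists! s : even_sheaf U, is_int_section k s.
Proof.
pose I := {Vc : opens M * int | Vc.1 `<=` U /\
  forall x : U, opens_set Vc.1 (val x) -> val k x = Vc.2}.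
pose W (i : I) := (sval i).1.
pose WU (i : I) : W i `<=` U := proj1 (svalP i).
pose s (i : I) : even_sheaf (W i) := even_int (sm_sheaf M (W i)) (sval i).2.
have cover : U `<=` \bigcup_i W i.
  move=> x Ux.
  pose x' : U := exist (fun y => y \in (U : set M)) x (mem_set Ux).
  have [V [VU Vx kV]] := lcst_nbhd k x'.
  have VUk : V `<=` U /\ forall y : U, opens_set V (val y) -> val k y = val k x'.
    by [].
  by exists (exist _ (V, val k x') VUk).
have [|t [ts tU]] := @ab_sheafP _ even_sheaf I U W WU cover s.
  move=> i j V Vi Vj; apply: val_inj; rewrite /= !rmorph_int.
  have [[x Vx]|V0] := pselect (exists x, opens_set V x).
    have Ux := WU i x (Vi x Vx).
    pose x' : U := exist (fun y => y \in (U : set M)) x (mem_set Ux).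
    have <- := proj2 (svalP i) x' (Vi x Vx).
    by have <- := proj2 (svalP j) x' (Vj x Vx).
  suff z1 (a b : sm_sheaf M V) : a = b by exact: z1.
  pose e (f : False) : opens M := False_rect _ f.
  have eU i' : e i' `<=` V by case: i'.
  apply: (super_sheaf_sep (sm_sheafP M) (WU := eU)) => [x Vx|[]].
  by case: V0; exists x.
exists t; split.
  move=> V VU c kc; pose i : I := exist _ (V, c) (conj VU kc).
  have -> : VU = WU i by exact: Prop_irrelevance.
  exact: (congr1 (fun u : even_part _ => val u) (ts i)).
move=> t' t'k; apply: tU => i; apply: val_inj.
exact: t'k (WU i) _ (proj2 (svalP i)).
Qed.

(* The inclusion of Z_M into O_{M,0}: a locally constant function k is sent to
   the section restricting to the scalar c wherever k is constant equal to c. *)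
Definition int_incl_fun (U : opens M) (k : int_sheaf M U) : even_sheaf U :=
  sval (cid (int_section_exists k)).

Lemma int_inclP (U : opens M) (k : int_sheaf M U) : is_int_section k (int_incl_fun k).
Proof. by rewrite /int_incl_fun; case: cid => s []. Qed.

Lemma int_incl_uniq (U : opens M) (k : int_sheaf M U) (s : even_sheaf U) :
  (forall x : U, exists (V : opens M) (VU : V `<=` U),
     opens_set V (val x) /\ sp_res (sm_sheaf M) VU (val s) = (val k x)%:~R) ->
  s = int_incl_fun k.
Proof.
move=> sk; apply: val_inj.
pose I := {V : opens M | exists VU : V `<=` U,
  sp_res (sm_sheaf M) VU (val s) = sp_res (sm_sheaf M) VU (val (int_incl_fun k))}.
pose W (i : I) := sval i.
have WU (i : I) : W i `<=` U by case: (svalP i).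
apply: (super_sheaf_sep (sm_sheafP M) (WU := WU)) => [x Ux|i]; last first.
  have [VU e] := svalP i; rewrite (_ : WU i = VU) //; exact: Prop_irrelevance.
pose x' : U := exist (fun y => y \in (U : set M)) x (mem_set Ux).
have [V [VU [Vx sV]]] := sk x'.
have [V' [V'U V'x kV']] := lcst_nbhd k x'.
have oVV' : open (V `&` V') by apply: openI; exact: opens_open.
have VV'U : Opens oVV' `<=` U by move=> y [/VU].
suff e : exists VU : Opens oVV' `<=` U,
    sp_res (sm_sheaf M) VU (val s) = sp_res (sm_sheaf M) VU (val (int_incl_fun k)).
  by exists (exist _ (Opens oVV') e).
exists VV'U; rewrite -(sp_res_comp VU (@subIsetl _ V V' : Opens oVV' `<=` V)) sV rmorph_int.
by rewrite (@int_inclP U k (Opens oVV') VV'U (val k x')) // => y [_ /kV'].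
Qed.

Lemma int_incl_zmod U : zmod_morphism (@int_incl_fun U).
Proof.
move=> k l; apply/esym/int_incl_uniq => x.
have [V [VU Vx kV]] := lcst_nbhd k x.
have [V' [V'U V'x lV']] := lcst_nbhd l x.
have oVV' : open (V `&` V') by apply: openI; exact: opens_open.
have VV'U : Opens oVV' `<=` U by move=> y [/VU].
exists (Opens oVV'), VV'U; split; first by [].
rewrite rmorphB (@int_inclP U k (Opens oVV') VV'U (val k x)); last by move=> y [/kV].
rewrite (@int_inclP U l (Opens oVV') VV'U (val l x)); last by move=> y [_ /lV'].
by rewrite -rmorphB.
Qed.

HB.instance Definition _ U :=
  GRing.isZmodMorphism.Build _ _ (@int_incl_fun U) (@int_incl_zmod U).

Lemma int_incl_res (U V : opens M) (VU : V `<=` U) (k : int_sheaf M U) :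
  int_incl_fun (ab_res (int_sheaf M) VU k) = ab_res even_sheaf VU (int_incl_fun k).
Proof.
apply/esym/int_incl_uniq => x.
have [V' [V'U V'x kV']] := lcst_nbhd k (sub_incl VU x).
have oVV' : open (V `&` V') by apply: openI; exact: opens_open.
have VV'V : Opens oVV' `<=` V by move=> y [].
have VV'U : Opens oVV' `<=` U by move=> y [_ /V'U].
exists (Opens oVV'), VV'V; split; first by split=> //; exact: set_mem (valP x).
rewrite [LHS](sp_res_comp _ _ VV'U).
by rewrite (@int_inclP U k (Opens oVV') VV'U (val k (sub_incl VU x))) // => y [_ /kV'].
Qed.

Definition int_incl : ab_hom (int_sheaf M) even_sheaf :=
  @AbHom M (int_sheaf M) even_sheaf (fun U => @int_incl_fun U) int_incl_res.

End Exponential.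

(* Main.v *)
Require Import Defs.
From HB Require Import structures.
From mathcomp Require Import all_boot all_order all_algebra.
From mathcomp Require Import complex ring lra zify.
From mathcomp Require Import all_classical all_reals all_analysis.
Import Order.TTheory GRing.Theory Num.Theory.
Import numFieldNormedType.Exports.

(** Over a superdomain an even section is a = f + nu with body f a holomorphic
    function and nu nilpotent, and its exponential is e^f times a finite sum in nu.
    Its value at a point z, an element of the exterior algebra over the complex
    numbers, is the exponential [gexp] of the value of a at z. A section y
    is the exponential of x in the sense of [is_exp] iff this holds for the values of
    x and y at every point of every chart ([is_expP]), which also shows that
    exponentials are unique.

    The point that needs care is that the exponential constructed in one chart is
    also the exponential in every other chart: a transition map is an abstract
    isomorphism of sheaves of superalgebras, with no continuity assumed, and need not
    commute with infinite sums. It does commute with algebraic identities, and it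
    preserves invertibility of germs, hence the vanishing of the body at a point
    ([body0_chart]). Now let c = f(z) and u = f - c. The function e^u differs from
    its Taylor polynomial of degree m + 1 by a multiple, in the ring of holomorphic
    functions, of u^(m+2). In any other chart u still has no constant term at the
    point, so the value of u^(m+2) there is zero because there are only m odd
    coordinates, and the image of the exponential is seen to take the expected value
    ([exp_decomp], [local_exp]). Existence over all open sets follows by gluing
    ([exp_exists]), and e^(x+y) = e^x e^y from the same identity in the exterior
    algebra.

    For surjectivity, the body g of an even invertible section has no zero, so it
    has a holomorphic logarithm near each point ([local_log]); the remaining factor
    is 1 plus a nilpotent, and the exponential of even nilpotents is onto these
    ([nil_exp_onto], by successive approximation along the powers of the
    augmentation ideal). For the kernel, if e^(2 pi i s) = 1 then at each point the
    value of s has integral constant term and no nilpotent part, by injectivity of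
    the nilpotent exponential; the integer is locally constant by continuity of the
    body ([exp_kernel_local]). *)

Set Implicit Arguments.
Unset Strict Implicit.
Unset Printing Implicit Defensive.

Local Open Scope classical_set_scope.
Local Open Scope ring_scope.

(** * Truncated exponentials and the nilpotent exponential *)

Section TruncatedExp.
Variables (F : numFieldType) (A : pzRingType) (sc : {rmorphism F -> A}).
Implicit Types x y : A.

Definition exp_term (x : A) (k : nat) : A := sc (k`!%:R^-1) * x ^+ k.
Definition exp_trunc (x : A) (N : nat) : A := \sum_(k < N) exp_term x k.

(** The image of 1 / k is central because that of k is. *)
Lemma sc_natV_comm (k : nat) x : (0 < k)%N -> GRing.comm (sc k%:R^-1) x.
Proof.
move=> k0; have kF : (k%:R : F) != 0 by rewrite pnatr_eq0 -lt0n.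
have kk : sc k%:R^-1 * k%:R = 1 by rewrite -(rmorph_nat sc k) -rmorphM mulVf ?rmorph1.
have kk' : k%:R * sc k%:R^-1 = 1 by rewrite -(rmorph_nat sc k) -rmorphM divff ?rmorph1.
rewrite /GRing.comm; set u := sc _ in kk kk' *.
transitivity (u * x * (k%:R * u)); first by rewrite kk' mulr1.
by rewrite mulrA -(mulrA u) (commr_nat x k) mulrA kk mul1r.
Qed.

Lemma exp_term0 x : exp_term x 0 = 1.
Proof. by rewrite /exp_term fact0 invr1 rmorph1 mul1r. Qed.

Lemma exp_term1 x : exp_term x 1 = x.
Proof. by rewrite /exp_term factS fact0 invr1 rmorph1 mul1r. Qed.

Lemma exp_termD x y N : GRing.comm x y ->
  exp_term (x + y) N = \sum_(j < N.+1) exp_term x (N - j) * exp_term y j.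
Proof.
move=> xy; rewrite /exp_term exprDn_comm // mulr_sumr; apply: eq_bigr => -[j /= jN] _.
have jN' : (j <= N)%N by rewrite -ltnS.
rewrite -mulrA [x ^+ _ * (_ * _)]mulrA.
rewrite -(sc_natV_comm (x ^+ (N - j)) (fact_gt0 j)) !mulrA -rmorphM -!mulrA.
rewrite -mulr_natr -[_ *+ 'C(N, j)]mulr_natl mulrA -(rmorph_nat sc) -rmorphM.
congr (sc _ * _).
have f0 k : (k`!%:R : F) != 0 by rewrite pnatr_eq0 -lt0n fact_gt0.
rewrite -(bin_fact jN') !natrM.
have b0 : ('C(N, j)%:R : F) != 0 by rewrite pnatr_eq0 -lt0n bin_gt0.
by field; rewrite b0 !f0.
Qed.

Lemma exp_truncS x N : exp_trunc x N.+1 = exp_trunc x N + exp_term x N.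
Proof. by rewrite /exp_trunc big_ord_recr. Qed.

(** A finite form of e^(x+y) = e^x e^y, by induction on [N]: the new term of the
    left side is the antidiagonal given by the binomial formula. Two uses: over the
    complex numbers the right side converges, and for nilpotent [y] the sum has
    boundedly many terms. *)
Lemma exp_truncD x y N : GRing.comm x y ->
  exp_trunc (x + y) N = \sum_(j < N) exp_trunc x (N - j) * exp_term y j.
Proof.
move=> xy; elim: N => [|N IHN]; first by rewrite /exp_trunc !big_ord0.
rewrite exp_truncS IHN exp_termD // !big_ord_recr /= !subSnn !subnn.
rewrite /exp_trunc big_ord1 addrA -big_split /=; congr (_ + _).
apply: eq_bigr => -[j /= jN] _; rewrite subSn 1?ltnW // big_ord_recr /=.
by rewrite mulrDl.
Qed.

(** The defect of multiplicativity only involves the terms x^i y^j with i + j >= N: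
    it is small for numbers and zero for nilpotents. *)
Lemma exp_trunc_mulB x y N : GRing.comm x y ->
  exp_trunc x N * exp_trunc y N - exp_trunc (x + y) N =
  \sum_(j < N) (exp_trunc x N - exp_trunc x (N - j)) * exp_term y j.
Proof.
move=> xy; rewrite exp_truncD // {2}/exp_trunc mulr_sumr -sumrB.
by apply: eq_bigr => j _; rewrite mulrBl.
Qed.

Lemma exp_trunc_sub x N M : (M <= N)%N ->
  exp_trunc x N - exp_trunc x M = \sum_(M <= k < N) exp_term x k.
Proof.
move=> MN; rewrite /exp_trunc -!(big_mkord xpredT (exp_term x)).
by rewrite (big_cat_nat (leq0n M) MN) /= addrAC subrr add0r.
Qed.

End TruncatedExp.

Lemma exp_trunc_morph (F : numFieldType) (A B : pzRingType)
  (sA : {rmorphism F -> A}) (sB : {rmorphism F -> B}) (f : {rmorphism A -> B}) :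
  (forall c, f (sA c) = sB c) ->
  forall x N, f (exp_trunc sA x N) = exp_trunc sB (f x) N.
Proof.
move=> fs x N; rewrite /exp_trunc rmorph_sum; apply: eq_bigr => i _.
by rewrite /exp_term rmorphM fs rmorphXn.
Qed.

HB.instance Definition _ (m : nat) (A : comPzRingType) (p : bool) :=
  GRing.isZmodClosed.Build _ (@grassmann_parity m A p) (@grassmann_parity_zmod m A p).

Section Filtration.
Variables (m : nat) (A : comPzRingType).
Implicit Types a b : grassmann m A.

(** The [k]-th power of the augmentation ideal of the exterior algebra. *)
Definition in_degree_ge (k : nat) : {pred grassmann m A} :=
  fun a => [forall S : {set 'I_m}, (#|S| < k)%N ==> (a S == 0)].

Lemma in_degree_geP k a :
  reflect (forall S : {set 'I_m}, (#|S| < k)%N -> a S = 0) (a \in in_degree_ge k).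
Proof.
by apply: (iffP forallP) => h S; [move/implyP: (h S) => /[apply] /eqP |
  apply/implyP => /h ->].
Qed.

Lemma in_degree_ge_zmod k : zmod_closed (in_degree_ge k).
Proof.
split=> [|a b /in_degree_geP ha /in_degree_geP hb]; apply/in_degree_geP => S Sk.
  by rewrite grassmann0E.
by rewrite grassmannDE grassmannNE ha // hb // subr0.
Qed.

HB.instance Definition _ k := GRing.isZmodClosed.Build _ (in_degree_ge k)
  (in_degree_ge_zmod k).

Lemma in_degree_geW k l a : (l <= k)%N -> a \in in_degree_ge k -> a \in in_degree_ge l.
Proof.
by move=> lk /in_degree_geP ha; apply/in_degree_geP => S Sl; apply/ha/(leq_trans Sl).
Qed.

Lemma in_degree_ge0 a : a \in in_degree_ge 0.
Proof. exact/in_degree_geP. Qed.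

Lemma in_degree_geM k l a b :
  a \in in_degree_ge k -> b \in in_degree_ge l -> a * b \in in_degree_ge (k + l).
Proof.
move=> /in_degree_geP ha /in_degree_geP hb; apply/in_degree_geP => S Skl.
rewrite grassmannME big1 // => I IS.
have [Ik|kI] := ltnP #|I| k; first by rewrite ha // mulr0 mul0r.
rewrite hb ?mulr0 //.
have : #|S| = (#|I| + #|S :\: I|)%N by rewrite -(cardsID I S) (finset.setIidPr IS).
move=> e; move: Skl; rewrite e => Skl.
by rewrite -(ltn_add2l #|I|) (leq_trans Skl) // leq_add2r.
Qed.

Lemma in_degree_geMl k a b : b \in in_degree_ge k -> a * b \in in_degree_ge k.
Proof. by move=> hb; have := in_degree_geM (in_degree_ge0 a) hb. Qed.

Lemma in_degree_geX k a i : a \in in_degree_ge k -> a ^+ i \in in_degree_ge (i * k).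
Proof.
move=> ha; elim: i => [|i IHi]; first exact: in_degree_ge0.
by rewrite exprS mulSn in_degree_geM.
Qed.

Lemma in_degree_ge_eq0 k a : (m < k)%N -> a \in in_degree_ge k -> a = 0.
Proof.
move=> mk /in_degree_geP ha; apply/ffunP => S; rewrite ha ?grassmann0E //.
by apply: leq_ltn_trans mk; rewrite -[X in (_ <= X)%N]card_ord max_card.
Qed.

Lemma in_degree_ge1P a : reflect (a finset.set0 = 0) (a \in in_degree_ge 1).
Proof.
apply: (iffP (in_degree_geP 1 a)) => [-> //|a0 S]; first by rewrite cards0.
by rewrite ltnS leqn0 cards_eq0 => /eqP ->.
Qed.

Lemma grassmannM0 a b : (a * b) finset.set0 = a finset.set0 * b finset.set0.
Proof.
rewrite grassmannME (big_pred1 finset.set0) => [|S]; last by rewrite /= finset.subset0.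
by rewrite finset.setDv inversions0l expr0 mul1r.
Qed.

Lemma even_grassmann_comm a b :
  a \in @grassmann_parity m A false -> b \in @grassmann_parity m A false ->
  GRing.comm a b.
Proof. by move=> ea eb; rewrite /GRing.comm (grassmann_supercomm ea eb) expr0 mul1r. Qed.

End Filtration.

Arguments in_degree_ge {m A}.

Section GrassmannExp.
Variables (F : numFieldType) (m : nat) (A : comPzRingType) (sc : {rmorphism F -> A}).
Implicit Types a b : grassmann m A.
Let S := grassmann_super m sc.
Local Notation even := (@grassmann_parity m A false).

(** Products of more than [m] elements without constant term vanish, so on these
    elements the truncation at [m.+2] is the full exponential series. The terms of
    degree 0 and 1 are always present, even for [m = 0]. *)
Definition nil_exp (a : grassmann m A) : grassmann m A :=
  exp_trunc (sa_scal S) a m.+2.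

Lemma exp_term_degree k a j : a \in in_degree_ge k ->
  exp_term (sa_scal S) a j \in in_degree_ge (j * k).
Proof. by move=> ha; rewrite in_degree_geMl // in_degree_geX. Qed.

Lemma nil_expD a b : GRing.comm a b -> a \in in_degree_ge 1 -> b \in in_degree_ge 1 ->
  nil_exp (a + b) = nil_exp a * nil_exp b.
Proof.
move=> ab ha hb; apply/esym/eqP; rewrite -subr_eq0 /nil_exp exp_trunc_mulB //.
rewrite big1 // => j _; rewrite exp_trunc_sub ?leq_subr // mulr_suml big_nat big1 // => i.
(* The remaining terms have i + j >= m + 2 nilpotent factors. *)
move=> /andP[ji _]; apply: (@in_degree_ge_eq0 _ _ (i * 1 + j * 1)).
  by rewrite !muln1; lia.
by apply: in_degree_geM; exact: exp_term_degree.
Qed.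

Lemma nil_exp0 : nil_exp 0 = 1.
Proof.
rewrite /nil_exp /exp_trunc big_ord_recl exp_term0 big1 ?addr0 // => i _.
by rewrite /exp_term expr0n mulr0.
Qed.

Lemma nil_exp_even a : a \in even -> nil_exp a \in even.
Proof.
move=> ea; rewrite /nil_exp /exp_trunc.
apply: (@big_ind _ (fun x : S => x \in sa_parity S false)).
- exact: rpred0.
- by move=> x y; exact: rpredD.
move=> i _; rewrite /exp_term.
apply: (sa_parityM (p := false) (q := false)); first exact: sa_scal_even.
elim: (nat_of_ord i) => [|j IHj]; first by rewrite expr0; exact: even1.
by rewrite exprS; exact: (sa_parityM (p := false) (q := false)).
Qed.

(** On the [k]-th step of the filtration, e^a = 1 + a up to the next step. This is
    what both the injectivity and the surjectivity of the nilpotent exponential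
    rest on. *)
Lemma nil_exp_approx k a : (0 < k)%N -> a \in in_degree_ge k ->
  nil_exp a - 1 - a \in in_degree_ge k.+1.
Proof.
move=> k0 ha; rewrite /nil_exp /exp_trunc !big_ord_recl exp_term0 exp_term1.
have cancel (u v w : grassmann m A) : u + (v + w) - u - v = w.
  by rewrite [u + _]addrC addrK [v + _]addrC addrK.
rewrite [X in X \in _]cancel.
apply: rpred_sum => i _; apply: in_degree_geW (exp_term_degree _ ha).
by rewrite !lift0 !mulSn addnA -addn1 -addnA leq_add // addn_gt0 k0.
Qed.

Lemma nil_exp_eq1 a : a \in in_degree_ge 1 -> nil_exp a = 1 -> a = 0.
Proof.
move=> a1 e1; apply: (@in_degree_ge_eq0 _ _ m.+1) => //.
suff H k : a \in in_degree_ge k.+1 by exact: H.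
elim: k => [//|k IHk].
have := nil_exp_approx (ltn0Sn k) IHk.
by rewrite e1 subrr add0r rpredN.
Qed.

Lemma nil_exp_degree a : a \in in_degree_ge 1 -> nil_exp a - 1 \in in_degree_ge 1.
Proof.
move=> a1; rewrite -[X in X \in _](subrK a) rpredD //.
exact: in_degree_geW (nil_exp_approx _ a1).
Qed.

Lemma nil_expN a : a \in in_degree_ge 1 -> nil_exp a * nil_exp (- a) = 1.
Proof.
move=> a1; rewrite -nil_expD ?subrr ?nil_exp0 ?rpredN //.
exact/commrN.
Qed.

(** A logarithm by successive approximation, which avoids composing power series:
    if a = 1 + mu with mu in step [k] of the filtration, then a e^(-mu) - 1 lies in
    step k+1, and a logarithm of a e^(-mu) plus mu is a logarithm of a. *)
Lemma nil_exp_onto a : a \in even -> a - 1 \in in_degree_ge 1 ->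
  exists b, [/\ b \in even, b \in in_degree_ge 1 & nil_exp b = a].
Proof.
(* Descending induction on the filtration step; d bounds the steps left. *)
suff main d k : (m.+1 <= k + d)%N -> (0 < k)%N -> forall a, a \in even ->
    a - 1 \in in_degree_ge k ->
    exists b, [/\ b \in even, b \in in_degree_ge 1 & nil_exp b = a].
  move=> ea a1; have := main m 1%N; rewrite add1n; apply=> //.
elim: d k => [|d IHd] k mkd k0 {}a ea ak.
  exists 0; split; rewrite ?rpred0 //.
  rewrite nil_exp0; apply/esym/eqP; rewrite -subr_eq0; apply/eqP.
  by apply: (in_degree_ge_eq0 _ ak); rewrite addn0 in mkd.
pose mu := a - 1.
have emu : mu \in even by rewrite rpredB // grassmann_parity1.
have mu1 : mu \in in_degree_ge 1 by exact: in_degree_geW ak.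
have [] := IHd k.+1 _ _ (a * nil_exp (- mu)).
- by rewrite addSnnS.
- by [].
- apply: (grassmann_parityM (p := false) (q := false)) => //.
  by apply: nil_exp_even; rewrite rpredN.
- have -> : a * nil_exp (- mu) - 1 = a * (nil_exp (- mu) - 1 - (- mu)) - mu * mu.
    have -> : a = 1 + mu by rewrite /mu addrC subrK.
    rewrite opprK mulrDr mulrBr mulr1 (mulrDl 1 mu mu) mul1r.
    move: ((1 + mu) * _) (mu * mu) => u v.
    by rewrite [u - _ + _]addrA addrK -addrA; congr (_ + _); rewrite opprD addrNK.
  rewrite rpredB //.
    by apply/in_degree_geMl/nil_exp_approx; rewrite ?rpredN.
  apply: in_degree_geW (in_degree_geM ak ak).
  by rewrite -addn1 leq_add2l.
move=> b [eb b1 bE]; exists (b + mu); split; [exact: rpredD | exact: rpredD |].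
rewrite nil_expD //; last exact: even_grassmann_comm.
have := @nil_expN (- mu); rewrite opprK rpredN => /(_ mu1) e.
by rewrite bE -mulrA e mulr1.
Qed.

End GrassmannExp.

(** * The complex exponential series *)

Ltac complex_ring :=
  apply/eqP; rewrite eq_complex /=; apply/andP; split; apply/eqP; ring.

Section ComplexExp.
Variable R : realType.
Local Notation C := (cplx R).
Local Notation E := (exp_trunc (@idfun C : {rmorphism C -> C})).
Local Notation term := (exp_term (@idfun C : {rmorphism C -> C})).
Local Notation Re := (@complex.Re R).
Local Notation Im := (@complex.Im R).
Implicit Types (z w : C) (x y : R).

(** The real numbers inside the normed field [cplx R]. *)
Definition rc (x : R) : C := Complex x 0.

Lemma rc_rmorph : zmod_morphism rc * monoid_morphism rc.
Proof. 
split; first by move=> x y; exact: (rmorphB (real_complex R)).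
by split=> [|x y]; [exact: (rmorph1 (real_complex R)) | exact: (rmorphM (real_complex R))].
Qed.
HB.instance Definition _ := GRing.isZmodMorphism.Build R C rc rc_rmorph.1.
HB.instance Definition _ := GRing.isMonoidMorphism.Build R C rc rc_rmorph.2.

Lemma normc_rc x : `|rc x| = rc `|x|.
Proof. by rewrite normc_def /= expr0n mulr0n addr0 sqrtr_sqr. Qed.

Lemma rc_le x y : (rc x <= rc y) = (x <= y). Proof. exact: lecR. Qed.
Lemma rc_lt x y : (rc x < rc y) = (x < y). Proof. exact: ltcR. Qed.

Lemma gt0_rc z : 0 < z -> exists2 x, 0 < x & z = rc x.
Proof.
case: z => a b; rewrite ltcE /= => /andP[/eqP b0 a0]; exists a => //.
by rewrite /rc b0.
Qed.

Lemma norm_rc z : exists2 x, 0 <= x & `|z| = rc x.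
Proof. by rewrite normc_def; eexists; last by []; exact: sqrtr_ge0. Qed.

Lemma cvg_rc T (F : set_system T) {FF : Filter F} (f : T -> R) x :
  f @ F --> x -> (fun t => rc (f t)) @ F --> rc x.
Proof.
move=> fx; apply/cvgrPdist_lt => _/gt0_rc[e e0 ->].
move/cvgrPdist_lt: fx => /(_ e e0); apply: filterS => t.
by rewrite -rmorphB normc_rc rc_lt.
Qed.

Lemma cvg_complex T (F : set_system T) {FF : Filter F} (f g : T -> R) x y :
  f @ F --> x -> g @ F --> y ->
  (fun t => Complex (f t) (g t) : C) @ F --> (Complex x y : C).
Proof.
move=> fx gy.
have CE a b : Complex a b = rc a + (Complex 0 1 : C) * rc b.
  by complex_ring.
rewrite CE; under eq_fun do rewrite CE.
by apply: cvgD; [exact: cvg_rc | apply: cvgM; [exact: cvg_cst | exact: cvg_rc]].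
Qed.

Lemma cvg_Re z : Re x @[x --> z] --> Re z.
Proof.
apply/(@cvgrPdist_lt _ _ _ _ (nbhs_filter z)) => e e0; have H : \forall w \near z, `|z - w| < rc e.
  by apply: (@cvgr_dist_lt _ C _ (nbhs z) _ id z); [exact: cvg_id | rewrite rc_lt].
near=> w; have : `|z - w| < rc e by near: w.
rewrite normc_def rc_lt => /(le_lt_trans _); apply.
rewrite -raddfB -sqrtr_sqr ler_wsqrtr // raddfB /=.
by case: (z) => a b; case: (w) => c d /=; rewrite lerDl sqr_ge0.
Unshelve. all: by end_near. Qed.

Lemma cvg_Im z : Im x @[x --> z] --> Im z.
Proof.
apply/(@cvgrPdist_lt _ _ _ _ (nbhs_filter z)) => e e0; have H : \forall w \near z, `|z - w| < rc e.
  by apply: (@cvgr_dist_lt _ C _ (nbhs z) _ id z); [exact: cvg_id | rewrite rc_lt].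
near=> w; have : `|z - w| < rc e by near: w.
rewrite normc_def rc_lt => /(le_lt_trans _); apply.
rewrite -sqrtr_sqr ler_wsqrtr //.
by case: (z) => a b; case: (w) => c d /=; rewrite lerDr sqr_ge0.
Unshelve. all: by end_near. Qed.

(** Given by the real functions, so that the functional equation and the periods
    come from those of [expR], [cos] and [sin]; [cvg_cexp] identifies it with the
    exponential series. *)
Definition cexp (z : C) : C :=
  Complex (expR (Re z) * cos (Im z)) (expR (Re z) * sin (Im z)).

Lemma cexpD z w : cexp (z + w) = cexp z * cexp w.
Proof.
case: z => a b; case: w => c d; rewrite /cexp /= expRD cosD sinD.
by complex_ring.
Qed.

Lemma cexp0 : cexp 0 = 1.
Proof. by rewrite /cexp /= expR0 cos0 sin0 mulr1 mulr0. Qed.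

Lemma cexpN z : cexp z * cexp (- z) = 1.
Proof. by rewrite -cexpD subrr cexp0. Qed.

Lemma cexp_neq0 z : cexp z != 0.
Proof. by apply/eqP => z0; have := cexpN z; rewrite z0 mul0r => /esym/eqP; rewrite oner_eq0. Qed.

Lemma expR_trunc x N : E (rc x) N = rc (series (exp_coeff x) N).
Proof.
rewrite /exp_trunc seriesEord /= rmorph_sum; apply: eq_bigr => i _.
by rewrite /exp_term /exp_coeff /= rmorphM fmorphV rmorph_nat rmorphXn /= mulrC.
Qed.

Lemma cvg_expR_trunc x : E (rc x) @ \oo --> rc (expR x).
Proof.
rewrite (_ : E (rc x) = fun N => rc (series (exp_coeff x) N)); last exact/funext/expR_trunc.
by apply: cvg_rc; exact: is_cvg_series_exp_coeff.
Qed.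

Lemma exp_trunc_iy y N :
  E (Complex 0 y : C) N = Complex (series (cos_coeff y) N) (series (sin_coeff y) N).
Proof.
elim: N => [|N IHN]; first by rewrite /exp_trunc !seriesEord /= !big_ord0.
rewrite exp_truncS IHN !seriesSr.
suff -> : term (Complex 0 y : C) N = Complex (cos_coeff y N) (sin_coeff y N) by [].
rewrite /exp_term /cos_coeff /sin_coeff /=.
have -> : (Complex 0 y : C) = Complex 0 1 * rc y.
  by complex_ring.
rewrite exprMn -rmorphXn /=.
have -> : (N`!%:R^-1 : C) = rc N`!%:R^-1 by rewrite fmorphV rmorph_nat.
have -> : (Complex 0 1 : C) ^+ N = Complex ((~~ odd N)%:R * (-1) ^+ N./2) ((odd N)%:R * (-1) ^+ N.-1./2).
  rewrite -{1}[N]odd_double_half exprD -mul2n exprM.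
  have -> : (Complex 0 1 : C) ^+ 2 = rc (-1) by rewrite sqr_i rmorphN1.
  rewrite -rmorphXn /=; case: (boolP (odd N)) => oN /=.
    have -> : N.-1./2 = N./2 by case: (N) oN => //= n; rewrite uphalf_half; case: odd.
    by rewrite expr1; complex_ring.
  by rewrite expr0 !mul1r !mul0r.
by rewrite -exprnP; complex_ring.
Qed.

Lemma cvg_exp_trunc_iy y :
  E (Complex 0 y : C) @ \oo --> (Complex (cos y) (sin y) : C).
Proof.
rewrite (_ : E _ = fun N => Complex (series (cos_coeff y) N) (series (sin_coeff y) N));
  last exact/funext/exp_trunc_iy.
apply: cvg_complex; rewrite ?cos.unlock ?sin.unlock.
  exact: is_cvg_series_cos_coeff.
exact: is_cvg_series_sin_coeff.
Qed.

Lemma norm_exp_term z k : `|term z k| = term `|z| k.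
Proof. by rewrite /exp_term normrM normrX normfV normr_nat. Qed.

Lemma exp_term_ge0 z k : 0 <= z -> 0 <= term z k.
Proof. by move=> z0; rewrite /exp_term mulr_ge0 ?exprn_ge0 // invr_ge0 ler0n. Qed.

Lemma norm_exp_trunc_sub z N M : (M <= N)%N ->
  `|E z N - E z M| <= E `|z| N - E `|z| M.
Proof.
move=> MN; rewrite !exp_trunc_sub //.
apply: le_trans (ler_norm_sum _ _ _) _.
by apply: ler_sum => i _; rewrite norm_exp_term.
Qed.

(** Termwise triangle inequality in [exp_trunc_mulB]; the right side is the same
    defect for the real numbers |z| and |w|, which tends to 0 because the real
    exponential is multiplicative. *)
Lemma norm_exp_trunc_mulB z w N :
  `|E z N * E w N - E (z + w) N| <= E `|z| N * E `|w| N - E (`|z| + `|w|) N.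
Proof.
rewrite !exp_trunc_mulB; [|exact: mulrC|exact: mulrC].
apply: le_trans (ler_norm_sum _ _ _) _; apply: ler_sum => j _.
rewrite normrM norm_exp_term ler_wpM2r ?exp_term_ge0 //.
exact/norm_exp_trunc_sub/leq_subr.
Qed.

Lemma cvg_exp_truncD z w (a b : C) :
  E z @ \oo --> a -> E w @ \oo --> b -> E (z + w) @ \oo --> a * b.
Proof.
move=> za wb.
have [x x0 zx] := norm_rc z; have [y y0 wy] := norm_rc w.
(* The product of the partial sums converges, so only their defect matters. *)
have diff0 : (E z N * E w N - E (z + w) N) @[N --> \oo] --> (0 : C).
  have bound0 : (E `|z| N * E `|w| N - E (`|z| + `|w|) N) @[N --> \oo] --> (0 : C).
    rewrite zx wy -rmorphD /=.
    have -> : (0 : C) = rc (expR x) * rc (expR y) - rc (expR (x + y)).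
      by rewrite expRD rmorphM subrr.
    by apply: (@cvgB C C nat \oo); [apply: (@cvgM C nat \oo)|]; exact: cvg_expR_trunc.
  apply/cvgr0Pnorm_lt => e e0; move/cvgr0Pnorm_lt: bound0 => /(_ e e0).
  apply: filterS => N; apply: le_lt_trans.
  have h := norm_exp_trunc_mulB z w N.
  by rewrite (ger0_norm (le_trans (normr_ge0 _) h)).
rewrite -[a * b]subr0.
rewrite (_ : E (z + w) = fun N => E z N * E w N - (E z N * E w N - E (z + w) N)); last first.
  by apply/funext => N; rewrite subKr.
exact: (@cvgB C C nat \oo _ _ _ _ _ (@cvgM C nat \oo _ _ _ _ _ za wb) diff0).
Qed.

(** The series is known on the real and on the imaginary axis; [cvg_exp_truncD]
    multiplies the two. *)
Lemma cvg_cexp z : E z @ \oo --> cexp z.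
Proof.
case: z => x y.
have -> : (Complex x y : C) = rc x + Complex 0 y by complex_ring.
have -> : cexp (rc x + Complex 0 y) = rc (expR x) * Complex (cos y) (sin y).
  by rewrite /cexp /= addr0 add0r; complex_ring.
by apply: cvg_exp_truncD; [exact: cvg_expR_trunc | exact: cvg_exp_trunc_iy].
Qed.

(** The terms of index >= N of the series are dominated by |z|^N / k!, whose sum is
    at most e |z|^N. *)
Lemma exp_trunc_bound z N : `|z| <= 1 ->
  `|cexp z - E z N| <= rc (expR 1) * `|z| ^+ N.
Proof.
move=> z1.
have bound M : (N <= M)%N -> `|E z M - E z N| <= rc (expR 1) * `|z| ^+ N.
  move=> NM; apply: le_trans (norm_exp_trunc_sub z NM) _.
  rewrite exp_trunc_sub //.
  apply: (@le_trans _ _ (\sum_(N <= k < M) term 1 k * `|z| ^+ N)).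
    rewrite !big_nat; apply: ler_sum => k /andP[Nk _].
    rewrite /exp_term expr1n mulr1 ler_wpM2l ?invr_ge0 ?ler0n //.
    exact: ler_wiXn2l.
  rewrite -mulr_suml ler_wpM2r ?exprn_ge0 // -exp_trunc_sub //.
  apply: (@le_trans _ _ (E 1 M)).
    by rewrite gerBl /exp_trunc sumr_ge0 // => i _; exact: exp_term_ge0.
  rewrite -[1](rmorph1 rc) expR_trunc rc_le.
  apply: nondecreasing_cvgn_le; last exact: is_cvg_series_exp_coeff.
  by apply: nondecreasing_series => k _ _; exact: exp_coeff_ge0.
apply/ler_addgt0Pr => e e0.
have [M _ HM] : \forall M \near \oo, `|cexp z - E z M| < e.
  by have /cvgrPdist_lt := @cvg_cexp z; apply.
pose K := maxn M N.
have -> : cexp z - E z N = (E z K - E z N) + (cexp z - E z K).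
  by rewrite [RHS]addrC addrA subrK.
apply: le_trans (ler_normD _ _) _; apply: lerD; first exact/bound/leq_maxr.
by apply/ltW/HM; rewrite /= leq_maxl.
Qed.

End ComplexExp.

(** * Derivative, local inverses and periods of the complex exponential *)

Section LocalLogarithm.
Variable R : realType.
Local Notation C := (cplx R).
Local Notation E := (exp_trunc (@idfun C : {rmorphism C -> C})).
Local Notation Re := (@complex.Re R).
Local Notation Im := (@complex.Im R).
Local Notation rc := (@rc R).
Local Notation cexp := (@cexp R).
Implicit Types (z w : C) (x y : R).

(** A quadratic error bound is how every complex derivative is obtained here from
    the estimate [exp_trunc_bound]. *)
Lemma differentiable_quadratic (f : C -> C) z (d K : C) : 0 < K ->
  (forall w, `|w| <= 1 -> `|f (w + z) - f z - d * w| <= K * `|w| ^+ 2) ->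
  differentiable f z.
Proof.
move=> K0 fK; apply/derivable1_diffP; apply/cvg_ex; exists d.
apply/(@cvgrPdist_le C C C _ _) => e e0.
near=> h.
have h0 : h != 0 by near: h; exact: withinT.
have h1 : `|h| <= 1 by near: h; exact: (@dnbhs0_le C C).
have he : `|h| <= e / K by near: h; apply: (@dnbhs0_le C C); exact: divr_gt0.
rewrite /= [h *: 1]mulr1 -[X in `|X - _|](mulfK h0) -[X in `|_ - X|]mulrC -mulrBl.
rewrite normrM normfV ler_pdivrMr ?normr_gt0 // distrC.
apply: le_trans (fK h h1) _.
by rewrite expr2 mulrA ler_wpM2r // mulrC -ler_pdivlMr.
Unshelve. all: by end_near. Qed.

Lemma near_neq0 z : z != 0 -> \forall w \near z, w != 0.
Proof. exact: (@cvgr_neq0 C C C (nbhs z) _ id z cvg_id). Qed.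

Lemma differentiable_cexp z : differentiable cexp z.
Proof.
apply: (@differentiable_quadratic _ _ (cexp z) (`|cexp z| * rc (expR 1))).
  by rewrite mulr_gt0 ?normr_gt0 ?cexp_neq0 // (rc_lt 0) expR_gt0.
move=> w w1; have -> : cexp (w + z) - cexp z - cexp z * w = cexp z * (cexp w - E w 2).
  by rewrite cexpD /exp_trunc !big_ord_recl big_ord0 exp_term0 exp_term1; ring.
by rewrite normrM -mulrA ler_wpM2l // exp_trunc_bound.
Qed.

Lemma differentiable_expn N z : differentiable (fun w : C => w ^+ N) z.
Proof. exact/derivable1_diffP/exprn_derivable. Qed.

Lemma differentiable_exp_trunc N z : differentiable (E^~ N) z.
Proof.
elim: N => [|N IHN].
  rewrite (_ : E^~ 0%N = cst 0); first exact: differentiable_cst.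
  by apply/funext => w; rewrite /exp_trunc big_ord0.
rewrite (_ : E^~ N.+1 = E^~ N + (cst N`!%:R^-1 * (fun w => w ^+ N))); last first.
  by apply/funext => w; rewrite exp_truncS.
apply: differentiableD => //; apply: differentiableM; first exact: differentiable_cst.
exact: differentiable_expn.
Qed.

(** The entire function (e^w - sum of the terms of degree < N) / w^N. Its being
    holomorphic also at 0 says that e^w is congruent to a polynomial modulo w^N in
    the ring of holomorphic functions, a purely algebraic property that every
    isomorphism of sheaves of algebras preserves. *)
Definition cexp_quot (N : nat) (w : C) : C :=
  if w == 0 then N`!%:R^-1 else (cexp w - E w N) / w ^+ N.

Lemma cexp_quotP N w : cexp w = E w N + w ^+ N * cexp_quot N w.
Proof.
rewrite /cexp_quot; have [->|w0] := eqVneq w 0; last first.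
  by rewrite mulrC divfK ?expf_neq0 // addrC subrK.
rewrite cexp0; case: N => [|N]; first by rewrite /exp_trunc big_ord0 expr0 fact0 invr1 mulr1 add0r.
rewrite expr0n mul0r addr0 /exp_trunc big_ord_recl exp_term0 big1 ?addr0 // => i _.
by rewrite /exp_term expr0n mulr0.
Qed.

Lemma differentiable_cexp_quot N z : differentiable (cexp_quot N) z.
Proof.
have [->|z0] := eqVneq z 0.
  apply: (@differentiable_quadratic _ _ (N.+1`!%:R^-1) (rc (expR 1))).
    by rewrite (rc_lt 0) expR_gt0.
  move=> w w1; rewrite addr0 /cexp_quot eqxx.
  have [->|w0] := eqVneq w 0; first by rewrite subrr mulr0 subrr normr0 expr0n mulr0.
  have wN : w ^+ N != 0 by rewrite expf_neq0.
  (* Taking the constant and linear terms off the quotient truncates two terms later. *)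
  have -> : (cexp w - E w N) / w ^+ N - N`!%:R^-1 - N.+1`!%:R^-1 * w =
            (cexp w - E w N.+2) / w ^+ N.
    apply: (mulIf wN); rewrite !(mulrBl (w ^+ N)) !mulfVK // !exp_truncS /exp_term /= exprS.
    by ring.
  rewrite normrM normfV normrX ler_pdivrMr ?exprn_gt0 ?normr_gt0 //.
  by rewrite -mulrA -exprD addnC addn2 exp_trunc_bound.
apply/derivable1_diffP.
apply: (@near_eq_derivable _ _ _ (fun w => (cexp w - E w N) / w ^+ N)) => //.
  by apply: filterS (near_neq0 z0) => w w0; rewrite /cexp_quot ifN.
apply/derivable1_diffP.
apply: (@differentiableM C C (cexp - E^~ N) (fun w => (w ^+ N)^-1)).
  by apply: differentiableB; [exact: differentiable_cexp | exact: differentiable_exp_trunc].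
by apply: differentiableV; [exact: differentiable_expn | rewrite expf_neq0].
Qed.

(** With u = L(z+h) - L(z), e^u - 1 = u q(u) where q = [cexp_quot 1] is continuous
    and q(0) = 1; hence u / h = 1 / (z q(u)) tends to 1 / z. A continuous branch of
    the logarithm is thus automatically holomorphic. *)
Lemma differentiable_cexp_inverse (L : C -> C) z : z != 0 ->
  L w @[w --> z] --> L z -> (\forall w \near z, cexp (L w) = w) ->
  differentiable L z.
Proof.
move=> z0 Lc LK; apply/derivable1_diffP; apply/cvg_ex.
pose u h := L (h + z) - L z.
have zL : cexp (L z) = z by exact: nbhs_singleton LK.
have shift0 : (h + z) @[h --> (0 : C)] --> z.
  rewrite -[X in _ --> X]add0r; apply: (@cvgD C C C (nbhs (0:C))); first exact: cvg_id.
  exact: cvg_cst.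
have u0 : u h @[h --> (0 : C)] --> (0 : C).
  rewrite -[X in _ --> X](subrr (L z)); apply: (@cvgB C C C (nbhs (0:C))); last exact: cvg_cst.
  exact: (cvg_comp _ _ shift0 Lc).
have qu : cexp_quot 1 (u h) @[h --> (0 : C)] --> (1 : C).
  have -> : (1 : C) = cexp_quot 1 0 by rewrite /cexp_quot eqxx invr1.
  apply: (cvg_comp _ _ u0); apply: differentiable_continuous.
  exact: differentiable_cexp_quot.
exists z^-1; apply: (@cvg_trans _ ((z * cexp_quot 1 (u h))^-1 @[h --> (0 : C)^'])); last first.
  have -> : z^-1 = (z * 1)^-1 by rewrite mulr1.
  apply: (@cvgV C C ((0 : C)^')); first by rewrite mulr1.
  apply: (@cvgM C C ((0 : C)^')); first exact: cvg_cst.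
  exact: cvg_within_filter qu.
apply: near_eq_cvg; near=> h.
have h0 : h != 0 by near: h; exact: withinT.
have hz : cexp (L (h + z)) = h + z.
  near: h; apply: cvg_within; exact: shift0 LK.
have hE : h = z * (u h * cexp_quot 1 (u h)).
  have := cexp_quotP 1 (u h); rewrite /exp_trunc big_ord1 exp_term0 expr1 => e.
  have : cexp (u h) * z = h + z.
    by rewrite -{1}zL -cexpD subrK.
  by rewrite e mulrDl mul1r [z + _]addrC => /addIr hE; rewrite -[LHS]hE mulrC.
have uq0 : u h * cexp_quot 1 (u h) != 0.
  by apply: contra h0 => /eqP e; rewrite hE e mulr0.
have un0 : u h != 0 by apply: contra uq0 => /eqP ->; rewrite mul0r.
have qn0 : cexp_quot 1 (u h) != 0 by apply: contra uq0 => /eqP ->; rewrite mulr0.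
rewrite /= [h *: 1]mulr1 -/(u h); have zq := mulf_neq0 z0 qn0.
apply: (mulIf zq); rewrite (mulVf zq) -[X in _ = X]mulrA [u h * _]mulrCA -hE.
by rewrite mulVf.
Unshelve. all: by end_near. Qed.

Lemma unit_circle x y : x ^+ 2 + y ^+ 2 = 1 -> exists t, cos t = x /\ sin t = y.
Proof.
move=> xy; have x1 : -1 <= x <= 1.
  rewrite -ler_norml -(expr_le1 (n := 2)) // -normrX ger0_norm ?sqr_ge0 //.
  by rewrite -xy lerDl sqr_ge0.
have yE : Num.sqrt (1 - x ^+ 2) = `|y| by rewrite -xy addrAC subrr add0r sqrtr_sqr.
(* [acos] only sees the upper half circle *)
have [y0|y0] := leP 0 y.
  by exists (acos x); rewrite acosK ?in_itv //= sin_acos // yE ger0_norm.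
exists (- acos x); rewrite cosN sinN acosK ?in_itv //= sin_acos // yE ltr0_norm //.
by rewrite opprK.
Qed.

Lemma cexp_onto z : z != 0 -> exists w, cexp w = z.
Proof.
case: z => a b z0.
have r0 : 0 < a ^+ 2 + b ^+ 2.
  rewrite lt_def addr_ge0 ?sqr_ge0 // andbT; apply: contra z0.
  by rewrite paddr_eq0 ?sqr_ge0 // !sqrf_eq0 eq_complex.
pose r := Num.sqrt (a ^+ 2 + b ^+ 2).
have rgt0 : 0 < r by rewrite sqrtr_gt0.
have [|t [ta tb]] := @unit_circle (a / r) (b / r).
  rewrite !expr_div_n -mulrDl sqr_sqrtr ?ltW // divff // gt_eqF //.
exists (Complex (ln r) t); rewrite /cexp /= lnK ?posrE // ta tb.
by rewrite ![r * _]mulrC !divfK // gt_eqF.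
Qed.

(** The principal branch, on the half-plane Re z > 0. *)
Definition clog (z : C) : C :=
  Complex (ln (Re z ^+ 2 + Im z ^+ 2) / 2) (atan (Im z / Re z)).

Lemma clogK z : 0 < Re z -> cexp (clog z) = z.
Proof.
case: z => a b /= a0.
have r0 : 0 < a ^+ 2 + b ^+ 2 by rewrite ltr_wpDr ?sqr_ge0 // exprn_gt0.
have rE : expR (ln (a ^+ 2 + b ^+ 2) / 2) = Num.sqrt (a ^+ 2 + b ^+ 2).
  apply/esym/eqP; rewrite -(eqrXn2 (n := 2)) ?sqrtr_ge0 ?expR_ge0 //.
  rewrite sqr_sqrtr ?ltW // -expRM_natr -mulrA mulVf ?mulr1 ?pnatr_eq0 //.
  by rewrite lnK ?posrE.
have cE : cos (atan (b / a)) = a / Num.sqrt (a ^+ 2 + b ^+ 2).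
  rewrite cos_atan.
  have -> : 1 + (b / a) ^+ 2 = (a ^+ 2 + b ^+ 2) / a ^+ 2.
    by rewrite mulrDl divff ?expf_neq0 ?gt_eqF // expr_div_n.
  rewrite sqrtrM ?ltW // sqrtrV ?sqr_ge0 // sqrtr_sqr gtr0_norm //.
  by rewrite invfM invrK mulrC.
have s0 : Num.sqrt (a ^+ 2 + b ^+ 2) != 0 by rewrite gt_eqF // sqrtr_gt0.
have c0 : cos (atan (b / a)) != 0 by rewrite cE mulf_neq0 ?invr_neq0 // gt_eqF.
have sE : sin (atan (b / a)) = b / Num.sqrt (a ^+ 2 + b ^+ 2).
  rewrite -[LHS](divfK c0) -/(tan _) atanK cE; field.
  by rewrite s0 gt_eqF.
rewrite /clog /cexp /= rE cE sE; congr Complex; field; exact: s0.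
Qed.

Lemma cvg_clog z : 0 < Re z -> clog w @[w --> z] --> clog z.
Proof.
move=> z0.
have cR : Re w @[w --> z] --> Re z by exact: cvg_Re.
have cI : Im w @[w --> z] --> Im z by exact: cvg_Im.
have sq (f : C -> R) : f w @[w --> z] --> f z -> f w * f w @[w --> z] --> f z * f z.
  by move=> fz; exact: (@cvgM R C (nbhs z)).
apply: (@cvg_complex R C (nbhs z) _ (fun w => ln (Re w ^+ 2 + Im w ^+ 2) / 2)
                                  (fun w => atan (Im w / Re w))).
  apply: (@cvgM R C (nbhs z)); last exact: cvg_cst.
  have r0 : 0 < Re z ^+ 2 + Im z ^+ 2 by rewrite ltr_wpDr ?sqr_ge0 // exprn_gt0.
  apply: (@continuous_cvg _ _ _ _ _ _ (@ln R)); first exact: continuous_ln.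
  by apply: (@cvgD R R C (nbhs z)); exact: sq.
apply: (@continuous_cvg _ _ _ _ _ _ (@atan R)); first exact: continuous_atan.
apply: (@cvgM R C (nbhs z)) => //; apply: (@cvgV R C (nbhs z)) => //.
by rewrite gt_eqF.
Qed.

(** Near z, rotate and scale to the half-plane of [clog]: L(w) = c + clog(w / z)
    where e^c = z. *)
Lemma local_log z : z != 0 -> exists L : C -> C,
  \forall w \near z, cexp (L w) = w /\ differentiable L w.
Proof.
move=> z0; have [c cz] := cexp_onto z0.
exists (fun w => c + clog (w / z)).
have cont w : (v / z) @[v --> w] --> w / z.
  by apply: (@cvgM C C (nbhs w)); [exact: cvg_id | exact: cvg_cst].
have near_half w : 0 < Re (w / z) -> \forall v \near w, 0 < Re (v / z).
  move=> w0; have := cvg_comp _ _ (cont w) (@cvg_Re R (w / z)).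
  by move=> /cvgr_gt; apply.
have inv w : 0 < Re (w / z) -> cexp (c + clog (w / z)) = w.
  by move=> w0; rewrite cexpD clogK // cz mulrC divfK.
have : \forall w \near z, 0 < Re (w / z).
  by apply: near_half; rewrite divff.
apply: filterS => w w0; split; first exact: inv.
apply: differentiable_cexp_inverse.
- by apply: contraTneq w0 => ->; rewrite mul0r ltxx.
- apply: (@cvgD C C C (nbhs w)); first exact: cvg_cst.
  exact: (cvg_comp _ _ (cont w) (cvg_clog w0)).
by apply: filterS (near_half w w0) => v; exact: inv.
Qed.

Lemma cexp_int (k : int) : cexp (two_pi_i R * k%:~R) = 1.
Proof.
have nat_case (n : nat) : cexp (two_pi_i R * n%:R) = 1.
  elim: n => [|n IHn]; first by rewrite mulr0 cexp0.
  rewrite mulrSr mulrDr mulr1 cexpD IHn mul1r /cexp /= expR0 !mul1r.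
  by rewrite mulrC mulr_natr cos2pi sin2pi.
case: k => n; first exact: nat_case.
have := cexpN (two_pi_i R * n.+1%:R).
by rewrite nat_case mul1r NegzE rmorphN mulrN.
Qed.

(** Subtract the multiple of the period that brings the imaginary part into
    [0, 2 pi), where the cosine takes the value 1 only at 0. *)
Lemma cexp_eq1 z : cexp z = 1 -> exists k : int, z = two_pi_i R * k%:~R.
Proof.
move=> z1; pose k := Num.floor (Im z / (2 * pi)); exists k.
have pi2 : 0 < 2 * pi :> R by rewrite mulr_gt0 ?pi_gt0.
have kz : cexp (z - two_pi_i R * k%:~R) = 1.
  by rewrite cexpD z1 mul1r -mulrN -mulrNz cexp_int.
suff : z - two_pi_i R * k%:~R = 0 by move/eqP; rewrite subr_eq0 => /eqP.
have im : 0 <= Im (z - two_pi_i R * k%:~R) < 2 * pi.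
  have -> : Im (z - two_pi_i R * k%:~R) = Im z - k%:~R * (2 * pi).
    have -> : (k%:~R : C) = rc k%:~R by rewrite rmorph_int.
    by rewrite raddfB /=; congr (_ - _); rewrite mulr0 add0r mulrC.
  rewrite subr_ge0 -ler_pdivlMr // ltrBlDr -{2}[2 * pi]mul1r -mulrDl -ltr_pdivrMr //.
  by have := Num.Theory.floor_itv (Im z / (2 * pi)); rewrite -/k intrD [_ + 1]addrC.
move: kz im; case: (z - _) => a b /=; rewrite /cexp /= => -[e1 e2] /andP[b0 b2].
have c2s2 : expR a ^+ 2 = 1.
  have := congr1 ( *%R (expR a ^+ 2)) (cos2Dsin2 b).
  by rewrite mulrDr -!exprMn e1 e2 expr0n expr1n /= addr0 mulr1 => <-.
have ea : expR a = 1.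
  by apply/eqP; rewrite -(eqrXn2 (n := 2)) ?expR_ge0 // c2s2 expr1n.
have -> : a = 0 by apply: expR_inj; rewrite ea expR0.
move: e1; rewrite ea mul1r => cb.
have b00 : b = 0.
  have [bpi|bpi] := leP b pi.
    by apply: cos_inj; rewrite ?in_itv /= ?b0 ?bpi ?lexx ?pi_ge0 // cos0.
  have : 2 * pi - b = 0.
    apply: cos_inj; rewrite ?in_itv /= ?lexx ?pi_ge0 //; first by apply/andP; split; lra.
    by rewrite -cosN opprB cosB mulr_natl cos2pi sin2pi mulr0 addr0 mulr1 cb cos0.
  lra.
by rewrite b00.
Qed.

End LocalLogarithm.

(** * The exponential on a complex exterior algebra *)

Section GrassmannConst.
Variables (m : nat) (A : comPzRingType).
Implicit Types a b : grassmann m A.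

Lemma grassmann_constM (c : A) a S : (grassmann_const m c * a) S = c * a S.
Proof.
rewrite grassmannME (bigD1 finset.set0) ?finset.sub0set //= big1 => [|I /andP[_ /negPf I0]].
  by rewrite ffunE eqxx finset.setD0 inversions0l expr0 mul1r addr0.
by rewrite ffunE I0 mulr0 mul0r.
Qed.

Lemma grassmann_Mconst (c : A) a S : (a * grassmann_const m c) S = c * a S.
Proof.
rewrite grassmannME (bigD1 S) //= big1 => [|I /andP[IS IneqS]].
  by rewrite ffunE finset.setDv eqxx inversions0r expr0 mul1r addr0 mulrC.
rewrite ffunE finset.setD_eq0; case: (boolP (S \subset I)) => [SI|]; last by rewrite mulr0.
by move: IneqS; rewrite finset.eqEsubset IS SI.
Qed.

Lemma grassmann_const_comm (c : A) a : GRing.comm (grassmann_const m c) a.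
Proof. by apply/ffunP => S; rewrite [LHS]grassmann_constM [RHS]grassmann_Mconst. Qed.

Lemma grassmann_const0 (c : A) : grassmann_const m c finset.set0 = c.
Proof. by rewrite ffunE eqxx. Qed.

Lemma sub_body_degree_ge1 a : a - grassmann_const m (a finset.set0) \in in_degree_ge 1.
Proof. by apply/in_degree_ge1P; rewrite grassmannDE grassmannNE grassmann_const0 subrr. Qed.

Lemma grassmann_bodyX a k : (a ^+ k) finset.set0 = a finset.set0 ^+ k.
Proof.
elim: k => [|k IHk]; first by rewrite !expr0 grassmann1E eqxx.
by rewrite !exprS grassmannM0 IHk.
Qed.

End GrassmannConst.

Lemma cvg_sum_ord (R : realType) n (f : nat -> 'I_n -> cplx R) (l : 'I_n -> cplx R) :
  (forall j, f^~ j @ \oo --> l j) ->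
  (fun N => \sum_j f N j) @ \oo --> \sum_j l j.
Proof.
elim: n f l => [|n IHn] f l fl.
  rewrite big_ord0; under eq_fun do rewrite big_ord0.
  exact: cvg_cst.
rewrite big_ord_recr; under eq_fun do rewrite big_ord_recr.
by apply: (@cvgD (cplx R) (cplx R) nat \oo); [apply: IHn => j; exact: fl | exact: fl].
Qed.

Section ComplexGrassmann.
Variables (R : realType) (m : nat).
Local Notation C := (cplx R).
Local Notation idC := (@idfun C : {rmorphism C -> C}).
Local Notation L := (grassmann m C).
Local Notation SL := (grassmann_super m idC).
Local Notation cexp := (@cexp R).
Local Notation gconst := (grassmann_const m).
Local Notation body a := (a finset.set0).
Implicit Types a b : L.

(** The exponential on a complex exterior algebra: split off the constant term, whose
    exponential is a number, and apply the finite series to the nilpotent rest. *)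
Definition gexp (a : L) : L :=
  gconst (cexp (body a)) * nil_exp idC (a - gconst (body a)).

Lemma gconst_exp_trunc (c : C) N :
  exp_trunc (sa_scal SL) (gconst c) N = gconst (exp_trunc idC c N).
Proof. by apply/esym/exp_trunc_morph. Qed.

(** By [exp_truncD], the N-th partial sum is a sum, over the bounded degree j of the
    nilpotent part, of partial sums of e^c of length N - j. *)
Lemma cvg_gexp a (I : {set 'I_m}) :
  (fun N => (exp_trunc (sa_scal SL) a N : L) I) @ \oo --> gexp a I.
Proof.
set c := body a; set nu := a - gconst c.
have nu1 : nu \in in_degree_ge 1 by exact: sub_body_degree_ge1.
have aE : a = gconst c + nu by rewrite /nu addrC subrK.
pose t j : L := exp_term (sa_scal SL) nu j.
pose s N := \sum_(j < m.+2) exp_trunc idC c (N - j) * t j I.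
have sumE (n : nat) (F : 'I_n -> L) S : (\sum_i F i) S = \sum_i F i S.
  by elim/big_rec2: _ => [|i u v _ <-]; rewrite ?grassmann0E ?grassmannDE.
have sE : \forall N \near \oo, s N = (exp_trunc (sa_scal SL) a N : L) I.
  exists m.+2 => //= N mN; rewrite aE exp_truncD; last exact: grassmann_const_comm.
  rewrite sumE /s (big_ord_widen_cond N predT (fun j => exp_trunc idC c (N - j) * t j I) mN).
  rewrite [RHS](bigID (fun j : 'I_N => (j < m.+2)%N)) /= [X in _ + X]big1 ?addr0.
    by apply: eq_bigr => j _; rewrite gconst_exp_trunc [RHS]grassmann_constM.
  move=> j; rewrite -leqNgt => mj; rewrite gconst_exp_trunc [LHS]grassmann_constM.
  rewrite [exp_term _ _ _](@in_degree_ge_eq0 _ _ j) ?grassmann0E ?mulr0 //.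
    exact: leq_trans mj.
  by have := exp_term_degree idC j nu1; rewrite muln1.
have cs : s @ \oo --> gexp a I.
  have -> : gexp a I = \sum_(j < m.+2) cexp c * t j I.
    by rewrite /gexp grassmann_constM -/c -/nu /nil_exp /exp_trunc sumE mulr_sumr.
  apply: (@cvg_sum_ord R) => j; apply: (@cvgM C nat \oo); last exact: cvg_cst.
  rewrite [X in X @ _](_ : _ = [sequence exp_trunc idC c (N - j)%N]_N) // cvg_centern.
  exact: cvg_cexp.
by apply: cvg_trans cs; exact: near_eq_cvg.
Qed.

Lemma gexp_split (c : C) (u : L) : body u = 0 -> gexp (gconst c + u) = gconst (cexp c) * nil_exp idC u.
Proof.
move=> u0; rewrite /gexp grassmannDE grassmann_const0 u0 addr0.
by rewrite addrAC subrr add0r.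
Qed.

Lemma gexp0 : gexp 0 = 1.
Proof. by rewrite /gexp grassmann0E cexp0 rmorph1 mul1r rmorph0 subr0 nil_exp0. Qed.

Lemma even_sub_body a : a \in @grassmann_parity m C false ->
  a - gconst (body a) \in @grassmann_parity m C false.
Proof. by move=> ea; rewrite rpredB // grassmann_const_even. Qed.

Lemma gexpD a b : a \in @grassmann_parity m C false -> b \in @grassmann_parity m C false ->
  gexp (a + b) = gexp a * gexp b.
Proof.
move=> ea eb; have ea' := even_sub_body ea; have eb' := even_sub_body eb.
have -> : a + b = gconst (body a + body b) +
    ((a - gconst (body a)) + (b - gconst (body b))).
  by rewrite rmorphD /= addrACA [gconst (body a) + _]addrC [gconst (body b) + _]addrC !subrK.
rewrite gexp_split; last first.
  by apply/in_degree_ge1P; rewrite rpredD // sub_body_degree_ge1.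
rewrite nil_expD ?sub_body_degree_ge1 //; last exact: even_grassmann_comm.
rewrite cexpD rmorphM /= /gexp -!mulrA; congr (_ * _).
by rewrite !mulrA; congr (_ * _); exact: grassmann_const_comm.
Qed.

Lemma body_nil_exp a : body a = 0 -> body (nil_exp idC a) = 1.
Proof.
move=> /in_degree_ge1P /(nil_exp_degree idC) /in_degree_ge1P.
by rewrite grassmannDE grassmannNE grassmann1E eqxx => /eqP; rewrite subr_eq0 => /eqP.
Qed.

Lemma body_gexp a : body (gexp a) = cexp (body a).
Proof.
rewrite grassmannM0 grassmann_const0 body_nil_exp ?mulr1 //.
exact/in_degree_ge1P/sub_body_degree_ge1.
Qed.

(** The constant term gives a period of the complex exponential; the nilpotent part
    is then 0 since the nilpotent exponential is injective. *)
Lemma gexp_eq1 a : gexp a = 1 -> exists k : int, a = gconst (two_pi_i R * k%:~R).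
Proof.
move=> a1; have := congr1 (fun u : L => body u) a1.
rewrite body_gexp grassmann1E eqxx => c1; have [k kE] := cexp_eq1 c1.
exists k; rewrite -kE; apply/eqP; rewrite -subr_eq0; apply/eqP.
apply: (@nil_exp_eq1 _ _ _ idC); first exact: sub_body_degree_ge1.
by move: a1; rewrite /gexp c1 rmorph1 mul1r.
Qed.

Lemma gexp_int (k : int) : gexp (gconst (two_pi_i R * k%:~R)) = 1.
Proof.
rewrite -[X in gexp X]addr0 gexp_split ?grassmann0E // cexp_int rmorph1 mul1r.
exact: nil_exp0.
Qed.

End ComplexGrassmann.

(** * Exponential and logarithm of superfunctions *)

Section SaHom.
Variables (F : fieldType).

Program Definition sa_comp (A B D : superalgebra F) (g : sa_hom B D) (f : sa_hom A B) : sa_hom A D :=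
  @SaHom F A D (g \o f : {rmorphism A -> D}) _ _.
Next Obligation. by move=> A B D g f c; rewrite /= !sa_fun_scal. Qed.
Next Obligation. by move=> A B D g f p x xp; do 2! apply: sa_fun_parity. Qed.

(** The odd component of x is sent to an odd element that is also even, hence to 0. *)
Lemma sa_hom_reflect_even (A B : superalgebra F) (f : sa_hom A B) x :
  injective f -> f x \in sa_parity B false -> x \in sa_parity A false.
Proof.
move=> finj efx; have [x0 [x1 [e0 o1 xE]]] := sa_parityD x.
suff x10 : x1 = 0 by rewrite xE x10 addr0.
apply: finj; rewrite rmorph0; apply: sa_parity0; last exact: sa_fun_parity.
have -> : x1 = x - x0 by rewrite xE addrAC subrr add0r.
by rewrite rmorphB; apply: (rpredB efx); exact: sa_fun_parity.
Qed.

End SaHom.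

Section ExpDecomp.
Variables (R : realType) (m : nat).
Local Notation C := (cplx R).
Local Notation cexp := (@cexp R).

(** An algebraic certificate: x is a number c plus u plus a nilpotent nu, and y is e^c
    times a truncated exponential of u, up to a multiple of a high power of u, times
    the exponential of nu. Where u vanishes, it forces the value of y to be the
    exponential of that of x ([exp_decomp_gexp]). It only involves the superalgebra
    operations, hence it is transported by every morphism, whereas the convergence
    of a series of functions a priori is not. *)
Definition exp_decomp (A : superalgebra C) (x y : A) (c : C) (u nu r : A) : Prop :=
  [/\ x = sa_scal A c + (u + nu),
      y = sa_scal A (cexp c) * ((exp_trunc (sa_scal A) u m.+2 + u ^+ m.+2 * r)
                                * exp_trunc (sa_scal A) nu m.+2),
      u \in sa_parity A false, nu \in sa_parity A false & nu ^+ m.+1 = 0].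

Lemma exp_decomp_hom (A B : superalgebra C) (f : sa_hom A B) x y c u nu r :
  exp_decomp x y c u nu r -> exp_decomp (f x) (f y) c (f u) (f nu) (f r).
Proof.
have ft z : f (exp_trunc (sa_scal A) z m.+2) = exp_trunc (sa_scal B) (f z) m.+2.
  by apply: exp_trunc_morph; exact: sa_fun_scal.
case=> -> -> eu env nu0; split; try exact: sa_fun_parity.
- by rewrite !rmorphD sa_fun_scal.
- by rewrite rmorphM rmorphM rmorphD rmorphM rmorphXn /= !ft sa_fun_scal.
by rewrite -rmorphXn nu0 rmorph0.
Qed.

Lemma exp_decomp_lift (A B : superalgebra C) (f : sa_hom A B) x (y' : B) c u' nu' r' :
  bijective f -> exp_decomp (f x) y' c u' nu' r' ->
  forall y, f y = y' ->
  exists u nu r, exp_decomp x y c u nu r /\ f u = u'.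
Proof.
case=> g gK Kg; have finj := can_inj gK.
have ft z : f (exp_trunc (sa_scal A) z m.+2) = exp_trunc (sa_scal B) (f z) m.+2.
  by apply: exp_trunc_morph; exact: sa_fun_scal.
case=> xE yE eu env nu0 y fy; exists (g u'), (g nu'), (g r'); split=> //; split.
- by apply: finj; rewrite !rmorphD sa_fun_scal !Kg.
- by apply: finj; rewrite rmorphM rmorphM rmorphD rmorphM rmorphXn /= !ft sa_fun_scal !Kg fy.
- by apply: (sa_hom_reflect_even finj); rewrite Kg.
- by apply: (sa_hom_reflect_even finj); rewrite Kg.
by apply: finj; rewrite rmorphXn rmorph0 /= Kg.
Qed.

(** In the exterior algebra over the complex numbers the power [u ^+ m.+2] is zero as
    soon as u has no constant term, so the unknown [r] disappears. *)
Lemma exp_decomp_gexp (x y : grassmann_super m (@idfun C : {rmorphism C -> C})) c u nu r :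
  exp_decomp x y c u nu r -> (u : grassmann m C) finset.set0 = 0 -> y = gexp x.
Proof.
case=> -> -> eu env nuN u0.
have nu0 : (nu : grassmann m C) finset.set0 = 0.
  have := congr1 (fun a : grassmann m C => a finset.set0) nuN.
  by rewrite grassmann_bodyX grassmann0E => /eqP; rewrite expf_eq0 /= => /eqP.
have uN : (u : grassmann m C) ^+ m.+2 = 0.
  apply: (@in_degree_ge_eq0 _ _ m.+2) => //; rewrite -[X in in_degree_ge X]muln1.
  exact/in_degree_geX/in_degree_ge1P.
rewrite [u ^+ _]uN mul0r addr0 [RHS]gexp_split; last first.
  by rewrite grassmannDE u0 nu0 addr0.
congr (_ * _); rewrite nil_expD //; last 2 first.
- exact/in_degree_ge1P.
- exact/in_degree_ge1P.
exact: even_grassmann_comm.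
Qed.

End ExpDecomp.

Section Sections.
Variables (R : realType) (n m : nat).
Local Notation C := (cplx R).
Local Notation Cn := 'rV[C]_n.
Local Notation cexp := (@cexp R).
Local Notation SL := (grassmann_super m (@idfun C : {rmorphism C -> C})).

Section Fixed.
Variable V : set Cn.
Local Notation G := (grassmann m (holo V)).
Local Notation D := (superdomain_obj m V).
Local Notation even := (@grassmann_parity m (holo V) false).
Local Notation hconst := (@holo_const R n V).
Local Notation gconst := (@grassmann_const m (holo V)).

Definition holo_ev (z : V) (f : holo V) : C := val f z.

Lemma holo_ev_zmod z : zmod_morphism (holo_ev z). Proof. by []. Qed.
Lemma holo_ev_monoid z : monoid_morphism (holo_ev z). Proof. by []. Qed.
HB.instance Definition _ z := GRing.isZmodMorphism.Build _ _ (holo_ev z) (holo_ev_zmod z).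
HB.instance Definition _ z := GRing.isMonoidMorphism.Build _ _ (holo_ev z) (holo_ev_monoid z).

Lemma jet_scal z c : grassmann_map (holo_ev z) (sa_scal D c) = sa_scal SL c.
Proof. exact: grassmann_map_const. Qed.

(** The value at a point of a superfunction: all its coefficients are evaluated. *)
Definition jet (z : V) : sa_hom D SL :=
  @SaHom C D SL (@grassmann_map m _ _ (holo_ev z)) (jet_scal z)
    (@grassmann_map_parity m _ _ (holo_ev z)).

Lemma jetE z (a : D) S : (jet z a : grassmann m C) S = val ((a : G) S) z.
Proof. by rewrite /= ffunE. Qed.

Lemma jet_sep (a b : D) : (forall z, jet z a = jet z b) -> a = b.
Proof.
move=> ab; apply/ffunP => S; apply: val_inj; apply/funext => z.
by rewrite -!jetE ab.
Qed.

Lemma holo_comp_subproof (g : C -> C) (f : holo V) :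
  (forall z, differentiable g (val f z)) -> (g \o val f) \in @holo_pred R n V.
Proof.
move=> dg; apply/asboolP => z; have /asboolP/(_ z)[f' [ff' df]] := valP f.
exists (g \o f'); split; first by move=> w /=; rewrite ff'.
by apply: differentiable_comp => //; rewrite ff'.
Qed.

Definition holo_comp (g : C -> C) (f : holo V)
  (dg : forall z, differentiable g (val f z)) : holo V :=
  Sub (g \o val f) (holo_comp_subproof dg).

(** With f the body of a, take y = e^f times the exponential of the nilpotent a - f.
    At z, write f = c + u with c = f(z); then e^f = e^c e^u, and [cexp_quotP] gives
    the form required by [exp_decomp], with r the holomorphic function
    [cexp_quot m.+2] of u. *)
Lemma superdomain_exp (a : D) : a \in even -> exists2 y : D, y \in even &
  forall z, exists c u nu r, exp_decomp m a y c u nu r /\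
    (jet z u : grassmann m C) finset.set0 = 0.
Proof.
move=> ea; set f : holo V := (a : G) finset.set0.
pose fe := holo_comp (fun z => differentiable_cexp (val f z)).
pose nu : G := a - gconst f.
have enu : nu \in even by rewrite rpredB // grassmann_const_even.
have nu1 : nu \in in_degree_ge 1 by exact: sub_body_degree_ge1.
exists (gconst fe * nil_exp hconst nu).
  apply: (grassmann_parityM (p := false) (q := false)); first exact: grassmann_const_even.
  exact: nil_exp_even.
move=> z; set c := val f z; pose u := f - hconst c.
pose r := holo_comp (fun w => differentiable_cexp_quot m.+2 (val u w)).
exists c, (gconst u), nu, (gconst r); split; last by rewrite jetE grassmann_const0; exact: subrr.
have tE : exp_trunc (sa_scal D) (gconst u) m.+2 = gconst (exp_trunc hconst u m.+2).
  by apply/esym/exp_trunc_morph.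
have evE (g : holo V) w : val (exp_trunc hconst g m.+2) w =
    exp_trunc (@idfun C : {rmorphism C -> C}) (val g w) m.+2.
  exact: (@exp_trunc_morph _ _ _ hconst (@idfun C : {rmorphism C -> C}) (holo_ev w)).
split; last first.
- apply: (@in_degree_ge_eq0 _ _ m.+1) => //; rewrite -[X in in_degree_ge X]muln1.
  exact: in_degree_geX.
- exact: enu.
- exact: grassmann_const_even.
- have yE : gconst fe = gconst (hconst (cexp c)) *
      (exp_trunc (sa_scal D) (gconst u) m.+2 + gconst u ^+ m.+2 * gconst r).
    rewrite tE -rmorphXn -(rmorphM gconst (u ^+ m.+2) r) -rmorphD -rmorphM.
    congr gconst; apply: val_inj; apply/funext => w.
    transitivity (cexp c * (exp_trunc (@idfun C : {rmorphism C -> C}) (val u w) m.+2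
                            + val u w ^+ m.+2 * cexp_quot m.+2 (val u w))).
      rewrite -cexp_quotP -cexpD; congr (cexp _).
      by rewrite [RHS]addrC [RHS]subrK.
    by rewrite -evE -[val u w]/(holo_ev w u) -(rmorphXn (holo_ev w)).
  by rewrite [X in _ = X]mulrA -yE.
rewrite /nu [X in _ = X]addrA.
have -> : sa_scal D c + gconst u = gconst f.
  by rewrite -[sa_scal D c]/(gconst (hconst c)) -(rmorphD gconst) addrC subrK.
by rewrite [RHS]addrC [RHS]subrK.
Qed.

(** An even superfunction with invertible body is its body times the exponential of
    an even nilpotent. *)
Lemma even_factor (a : G) (g : holo V) : a \in even -> (a : G) finset.set0 * g = 1 ->
  exists b, [/\ b \in even, b \in in_degree_ge 1 & 
    a = gconst (a finset.set0) * nil_exp hconst b].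
Proof.
move=> ea fg; set f := a finset.set0 in fg *.
have [||b [eb b1 bE]] := @nil_exp_onto _ _ _ hconst (gconst g * a).
- by apply: (grassmann_parityM (p := false) (q := false)) => //; exact: grassmann_const_even.
- apply/in_degree_ge1P; rewrite grassmannDE grassmannNE grassmann1E eqxx.
  by rewrite grassmann_constM mulrC fg subrr.
by exists b; split=> //; rewrite bE mulrA -rmorphM /= fg rmorph1 mul1r.
Qed.

Lemma holo_inv (f : holo V) : (forall z, val f z != 0) -> exists g, f * g = 1.
Proof.
move=> f0; have dV z : differentiable (fun w : C => w^-1) (val f z).
  by apply: (@differentiableV C C id).
exists (holo_comp dV); apply: val_inj; apply/funext => z.
exact: divff (f0 z).
Qed.

Lemma even_invertible (a : D) : a \in even ->
  (forall z, val ((a : G) finset.set0) z != 0) -> invertible a.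
Proof.
move=> ea a0; have [g fg] := holo_inv a0; have [b [eb b1 aE]] := even_factor ea fg.
have inv : a * (gconst g * nil_exp hconst (- b)) = 1.
  rewrite aE mulrA -[_ * gconst g]mulrA -[_ * gconst g](grassmann_const_comm g).
  by rewrite mulrA -rmorphM /= fg rmorph1 mul1r nil_expN.
exists (gconst g * nil_exp hconst (- b)); split; first exact: inv.
rewrite -[RHS]inv; apply: even_grassmann_comm; last exact: ea.
apply: (grassmann_parityM (p := false) (q := false)); first exact: grassmann_const_even.
by apply: nil_exp_even; rewrite rpredN.
Qed.

(** Apply the branch [L] to the body, and [even_factor] to the rest. *)
Lemma superdomain_log (a : D) (L : C -> C) : a \in even ->
  (forall z, [/\ val ((a : G) finset.set0) z != 0,
     cexp (L (val ((a : G) finset.set0) z)) = val ((a : G) finset.set0) z &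
     differentiable L (val ((a : G) finset.set0) z)]) ->
  exists2 x : D, x \in even & forall z, gexp (jet z x) = jet z a.
Proof.
move=> ea aL; set f := (a : G) finset.set0 in aL *.
have [|g fg] := @holo_inv f; first by move=> z; case: (aL z).
have [b [eb b1 aE]] := even_factor ea fg.
have dL z : differentiable L (val f z) by case: (aL z).
exists (gconst (holo_comp dL) + b).
  exact: (@rpredD _ even _ _ (grassmann_const_even m (holo_comp dL)) eb).
move=> z; rewrite [in RHS]aE.
have jc (h : holo V) : jet z (gconst h) = grassmann_const m (val h z).
  exact: (@grassmann_map_const m _ _ (holo_ev z) h).
have -> : jet z (gconst (holo_comp dL) + b) = grassmann_const m (L (val f z)) + jet z b.
  by rewrite -[L _]/(val (holo_comp dL) z) -jc; exact: rmorphD.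
have -> : jet z (gconst f * nil_exp hconst b) = grassmann_const m (val f z) * jet z (nil_exp hconst b).
  by rewrite -jc; exact: rmorphM.
rewrite gexp_split; last first.
  by rewrite jetE; move/in_degree_ge1P: b1 => ->.
congr (_ * _).
  by congr grassmann_const; case: (aL z).
exact/esym/(exp_trunc_morph (jet_scal z)).
Qed.

End Fixed.
End Sections.

(** * Values of sections in charts *)

Section Jets.
Variables (R : realType) (n m : nat) (M : supermanifold R n m).
Local Notation C := (cplx R).
Local Notation Cn := 'rV[C]_n.
Local Notation O := (sm_sheaf M).
Local Notation SL := (grassmann_super m (@idfun C : {rmorphism C -> C})).
Local Notation body a := ((a : grassmann m C) finset.set0).
Local Notation chart := (chart n m O).
Implicit Types (c : chart) (U V : opens M) (p : M).

Definition opensI (X : topologicalType) (U V : opens X) : opens X :=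
  Opens (openI (opens_open U) (opens_open V)).

Definition chart_img c U : opens Cn :=
  Opens (ch_open (c := c) (W := opensI U (ch_dom c)) (@subIsetr _ _ _)).

Lemma chart_img_cod c U : chart_img c U `<=` ch_cod c.
Proof.
move=> _ [q [_ dq] <-]; have [cf _ _] := ch_bij c; exact: cf.
Qed.

Lemma preimage_chart_img c U : preimage_opens (@ch_cont _ _ _ _ _ c) (chart_img c U) `<=` U.
Proof.
move=> p [dp [q [Uq dq] qp]]; have [_ inj _] := ch_bij c.
by rewrite -(inj q p) // mem_set.
Qed.

Lemma chart_img_mem c U p : opens_set U p -> opens_set (ch_dom c) p ->
  ch_map c p \in (chart_img c U : set Cn).
Proof. by move=> Up dp; apply: mem_set; exists p. Qed.

(** The value at [p] of a section over [U], read in the chart [c]. Taking the section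
    on the image of all of [U] makes this a function of the point, the chart and the
    section only; [chart_jetE] compares it with any other chart domain. *)
Definition point_jet c U p (Up : opens_set U p) (dp : opens_set (ch_dom c) p) :
    sa_hom (O U) SL :=
  sa_comp (jet m (exist _ (ch_map c p) (chart_img_mem Up dp)))
    (sa_comp (ch_iso (chart_img_cod (U := U))) (sp_res O (preimage_chart_img (U := U)))).

Lemma jet_res (W W' : opens Cn) (W'W : W' `<=` W) (z' : W') (z : W) (a : superdomain R n m W) :
  val z' = val z -> jet m z' (sp_res (superdomain R n m) W'W a) = jet m z a.
Proof.
move=> zz; apply/ffunP => S; rewrite !jetE.
transitivity (val ((a : grassmann m (holo W)) S) (sub_incl W'W z')).
  by rewrite [X in val X]ffunE.
by congr (val _ _); apply: val_inj.
Qed.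

Lemma chart_jet_res c (W W' : opens Cn) (WV : W `<=` ch_cod c) (W'V : W' `<=` ch_cod c)
    (W'W : W' `<=` W) U (WU : preimage_opens (@ch_cont _ _ _ _ _ c) W `<=` U)
    (W'U : preimage_opens (@ch_cont _ _ _ _ _ c) W' `<=` U) (z : W) (z' : W') (s : O U) :
  val z' = val z ->
  jet m z' (ch_iso W'V (sp_res O W'U s)) = jet m z (ch_iso WV (sp_res O WU s)).
Proof.
move=> zz.
have pW : preimage_opens (@ch_cont _ _ _ _ _ c) W' `<=` preimage_opens (@ch_cont _ _ _ _ _ c) W.
  by move=> q [dq W'q]; split=> //; exact: W'W.
by rewrite -(sp_res_comp WU pW W'U) (ch_iso_res WV W'V W'W pW) (jet_res W'W _ zz).
Qed.

Lemma chart_jetE c (W : opens Cn) (WV : W `<=` ch_cod c) U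
    (WU : preimage_opens (@ch_cont _ _ _ _ _ c) W `<=` U) (z : W) (s : O U) p
    (Up : opens_set U p) (dp : opens_set (ch_dom c) p) :
  val z = ch_map c p ->
  jet m z (ch_iso WV (sp_res O WU s)) = point_jet Up dp s.
Proof.
move=> zp; apply: chart_jet_res => //.
move=> w Ww; have [_ _ surj] := ch_bij c; have [q dq qw] := surj w (WV w Ww).
by exists q => //; split=> //; apply: WU; split=> //; rewrite /= qw.
Qed.

Lemma point_jet_res c U V (VU : V `<=` U) p (Up : opens_set U p) (Vp : opens_set V p)
    (dp : opens_set (ch_dom c) p) (s : O U) :
  point_jet Vp dp (sp_res O VU s) = point_jet Up dp s.
Proof.
rewrite -[LHS]/(jet m _ (ch_iso _ (sp_res O _ (sp_res O VU s)))).
have WU : preimage_opens (@ch_cont _ _ _ _ _ c) (chart_img c V) `<=` U.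
  by move=> q /preimage_chart_img /VU.
by rewrite (sp_res_comp _ _ WU); exact: chart_jetE.
Qed.

(** By [cvg_gexp] the convergence required at each point has limit [gexp], and limits
    are unique. Being an exponential thereby becomes a condition on the values at
    points. *)
Lemma is_expP U (x y : O U) : is_exp x y <->
  forall c p (Up : opens_set U p) (dp : opens_set (ch_dom c) p),
    point_jet Up dp y = gexp (point_jet Up dp x).
Proof.
have coefE (W : opens Cn) (a : superdomain R n m W) I z : coef_at a I z = (jet m z a : grassmann m C) I.
  by rewrite jetE.
have psumE (W : opens Cn) (a : superdomain R n m W) (z : W) N :
    jet m z (exp_psum a N) = exp_trunc (sa_scal SL) (jet m z a) N.
  by apply: exp_trunc_morph; exact: jet_scal.
split=> [xy c p Up dp|xy c W WV WU I z].
  apply/ffunP => I.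
  have := xy c (chart_img c U) (@chart_img_cod c U) (@preimage_chart_img c U) I
    (exist _ (ch_map c p) (chart_img_mem Up dp)).
  rewrite coefE => h1.
  apply: (cvg_unique (@norm_hausdorff C C)) h1 _ => /=.
  under eq_fun do rewrite coefE psumE.
  exact: cvg_gexp.
have [_ _ surj] := ch_bij c; have [p dp pz] := surj (val z) (WV _ (set_mem (valP z))).
have Up : opens_set U p by apply: WU; split=> //=; rewrite pz; exact: set_mem (valP z).
rewrite coefE (chart_jetE WV WU y Up dp) // xy.
under eq_fun do rewrite coefE psumE (chart_jetE WV WU x Up dp (esym pz)).
exact: cvg_gexp.
Qed.

End Jets.

(** * Existence of the exponential near a point *)

Section LocalExistence.
Variables (R : realType) (n m : nat) (M : supermanifold R n m).
Local Notation C := (cplx R).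
Local Notation Cn := 'rV[C]_n.
Local Notation O := (sm_sheaf M).
Local Notation SL := (grassmann_super m (@idfun C : {rmorphism C -> C})).
Local Notation body a := ((a : grassmann m C) finset.set0).
Local Notation chart := (chart n m O).
Local Notation pre c W := (preimage_opens (@ch_cont _ _ _ _ _ c) W).
Implicit Types (c : chart) (U V : opens M) (p : M).

Lemma chart_sep c (W : opens Cn) (WV : W `<=` ch_cod c) (s t : O (pre c W)) :
  (forall z, jet m z (ch_iso WV s) = jet m z (ch_iso WV t)) -> s = t.
Proof. by move=> st; apply: (bij_inj (ch_iso_bij WV)); exact: jet_sep. Qed.

Lemma point_jet_sep U (s t : O U) :
  (forall c p (Up : opens_set U p) (dp : opens_set (ch_dom c) p),
     point_jet Up dp s = point_jet Up dp t) -> s = t.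
Proof.
move=> st; pose W c := pre c (chart_img c U).
have WU c : W c `<=` U by exact: preimage_chart_img.
apply: (super_sheaf_sep (sm_sheafP M) (WU := WU)) => [p Up|c].
  have [c dp] := sm_charts p; exists c => //.
  by split=> //; exists p.
apply: (chart_sep (WV := @chart_img_cod _ _ _ _ c U)) => -[z Wz].
have [p [Up dp] pz] := set_mem Wz.
have jE u := @chart_jetE _ _ _ _ c _ (@chart_img_cod _ _ _ _ c U) U (WU c)
  (exist _ z Wz) u p Up dp (esym pz).
by rewrite !jE st.
Qed.

Lemma is_exp_res U V (VU : V `<=` U) (x y : O U) :
  is_exp x y -> is_exp (sp_res O VU x) (sp_res O VU y).
Proof.
move=> /is_expP xy; apply/is_expP => c p Vp dp.
by rewrite !(point_jet_res VU (VU _ Vp)).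
Qed.

Lemma is_exp_uniq U (x y y' : O U) : is_exp x y -> is_exp x y' -> y = y'.
Proof.
by move=> /is_expP xy /is_expP xy'; apply: point_jet_sep => c p Up dp; rewrite xy xy'.
Qed.

(** The body of a section in a chart is continuous, so an open condition on its value
    at a point holds on a neighbourhood. *)
Lemma body_near c U p (Up : opens_set U p) (dp : opens_set (ch_dom c) p) (s : O U)
    (P : set C) : (\forall w \near body (point_jet Up dp s), P w) ->
  exists (W : opens Cn) (WV : W `<=` ch_cod c) (WU : pre c W `<=` U),
    opens_set W (ch_map c p) /\
    forall z : W, P (body (jet m z (ch_iso WV (sp_res O WU s)))).
Proof.
pose W0 := chart_img c U; pose a := ch_iso (@chart_img_cod _ _ _ _ c U)
   (sp_res O (@preimage_chart_img _ _ _ _ c U) s).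
pose z0 : W0 := exist _ (ch_map c p) (chart_img_mem Up dp).
have -> : body (point_jet Up dp s) = val ((a : grassmann m (holo W0)) finset.set0) z0.
  exact: (jetE z0 a).
have /asboolP/(_ z0)[f [fE df]] := valP ((a : grassmann m (holo W0)) finset.set0).
rewrite -fE => nP.
have nQ : nbhs (val z0) (f @^-1` P `&` W0).
  apply: filterI; first exact: (differentiable_continuous df nP).
  by apply: open_nbhs_nbhs; split; [exact: opens_open | exact: set_mem (valP z0)].
move: nQ; rewrite nbhsE => -[W [oW Wz] WQ].
have WW0 : Opens oW `<=` W0 by move=> z /WQ[].
have WV : Opens oW `<=` ch_cod c by move=> z /WW0 /chart_img_cod.
have WU : pre c (Opens oW) `<=` U.
  by move=> q [dq Wq]; apply: (@preimage_chart_img _ _ _ _ c U); split=> //; exact: WW0.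
exists (Opens oW), WV, WU; split=> // z.
have W0z : val z \in (W0 : set Cn) by apply/mem_set/WW0/set_mem/valP.
rewrite (chart_jet_res (@chart_img_cod _ _ _ _ c U) WV WW0
  (@preimage_chart_img _ _ _ _ c U) WU (z := exist _ (val z) W0z)) // -/a jetE -fE.
by case: (WQ _ (set_mem (valP z))).
Qed.

Lemma germ_invertible_body c U p (Up : opens_set U p) (dp : opens_set (ch_dom c) p) (s : O U) :
  germ_invertible p s -> body (point_jet Up dp s) != 0.
Proof.
case=> V [VU [Vp [t [st _]]]]; rewrite -(point_jet_res VU Up Vp dp).
have e : point_jet Vp dp (sp_res O VU s) * point_jet Vp dp t = 1.
  by rewrite -rmorphM st rmorph1.
have := congr1 (fun a : grassmann m C => a finset.set0) e.
rewrite [X in X = _]grassmannM0 [X in _ = X]grassmann1E eqxx => e1.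
by apply/eqP => s0; move/eqP: e1; rewrite s0 mul0r eq_sym oner_eq0.
Qed.

Lemma bij_reflect_invertible (F : fieldType) (A B : superalgebra F) (f : sa_hom A B) x :
  bijective f -> invertible (f x) -> invertible x.
Proof.
case=> g gK Kg [y [xy yx]]; exists (g y); split; apply: (can_inj gK);
  by rewrite rmorphM rmorph1 Kg.
Qed.

(** Near [p] the body has no zero, and an even superfunction whose body has no zero
    is invertible. *)
Lemma body_germ_invertible c U p (Up : opens_set U p) (dp : opens_set (ch_dom c) p) (s : O U) :
  s \in sa_parity (O U) false -> body (point_jet Up dp s) != 0 -> germ_invertible p s.
Proof.
move=> es s0.
have [|W [WV [WU [Wp sW]]]] := @body_near c U p Up dp s (fun w => w != 0).
  exact: near_neq0 s0.
exists (pre c W), WU; split; first by split.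
apply: (bij_reflect_invertible (ch_iso_bij WV)); apply: even_invertible.
  by apply: sa_fun_parity; exact: sa_fun_parity.
by move=> z; rewrite -jetE; exact: sW.
Qed.

(** The body vanishes at [p] in a chart iff the germ is not invertible, and the latter
    does not mention the chart. *)
Lemma body0_chart c c' U p (Up : opens_set U p) (dp : opens_set (ch_dom c) p)
    (dp' : opens_set (ch_dom c') p) (s : O U) : s \in sa_parity (O U) false ->
  body (point_jet Up dp s) = 0 -> body (point_jet Up dp' s) = 0.
Proof.
move=> es s0; apply/eqP; apply: contraT => /(body_germ_invertible es).
by move=> /(germ_invertible_body Up dp); rewrite s0 eqxx.
Qed.

(** The exponential is constructed in one chart, but [is_exp] must hold in all charts.
    The certificate [exp_decomp] at a point is pulled back to the supermanifold and
    pushed to any other chart; the section u still vanishes there by [body0_chart]. *)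
Lemma local_exp U (x : O U) p : x \in sa_parity (O U) false -> opens_set U p ->
  exists (V : opens M) (VU : V `<=` U) (y : O V),
    [/\ opens_set V p, y \in sa_parity (O V) false & is_exp (sp_res O VU x) y].
Proof.
move=> ex Up; have [c dp] := sm_charts p.
pose W := chart_img c U; have WV : W `<=` ch_cod c by exact: chart_img_cod.
have WU : pre c W `<=` U by exact: preimage_chart_img.
have [|y' ey' y'P] := @superdomain_exp R n m W (ch_iso WV (sp_res O WU x)).
  by apply: sa_fun_parity; exact: sa_fun_parity.
have bij := ch_iso_bij WV; have [g gK Kg] := bij.
exists (pre c W), WU, (g y'); split.
- by split=> //; exists p.
- by apply: (sa_hom_reflect_even (can_inj gK)); rewrite Kg.
apply/is_expP => c' q Vq dq'.
have [dq Wq] := Vq.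
pose z : W := exist _ (ch_map c q) (mem_set Wq).
have [c0 [u' [nu' [r' [dec u0]]]]] := y'P z.
(* dec is an identity in the first chart, dec' the same one on the supermanifold. *)
have [u [nu [r [dec' uE]]]] := exp_decomp_lift bij dec (Kg y').
have jz (s : O (pre c W)) : jet m z (ch_iso WV s) = point_jet Vq dq s.
  rewrite -(@chart_jetE _ _ _ _ c W WV (pre c W) (@subset_refl _ _) z) //.
  by rewrite sp_res_id.
have eu : u \in sa_parity (O (pre c W)) false by case: dec'.
have b0 : body (point_jet Vq dq' u) = 0.
  by apply: (body0_chart (dp := dq)) => //; rewrite -jz uE.
exact: exp_decomp_gexp (exp_decomp_hom (point_jet Vq dq') dec') b0.
Qed.

End LocalExistence.

(** * The exponential map of sheaves *)

Section ExpHom.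
Variables (R : realType) (n m : nat) (M : supermanifold R n m).
Local Notation C := (cplx R).
Local Notation Cn := 'rV[C]_n.
Local Notation O := (sm_sheaf M).
Local Notation SL := (grassmann_super m (@idfun C : {rmorphism C -> C})).
Local Notation body a := ((a : grassmann m C) finset.set0).
Local Notation chart := (chart n m O).
Local Notation pre c W := (preimage_opens (@ch_cont _ _ _ _ _ c) W).
Implicit Types (c : chart) (U V : opens M) (p : M).

(** The local exponentials agree on overlaps since exponentials are unique, so they
    glue; evenness is local, and [is_exp] is a condition at points. *)
Lemma exp_exists U (x : O U) : x \in sa_parity (O U) false ->
  exists2 y : O U, y \in sa_parity (O U) false & is_exp x y.
Proof.
move=> ex.
(* The index carries the exponential itself, so that no choice is made. *)
pose I := {V : opens M & {VU : V `<=` U & {y : O V |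
  y \in sa_parity (O V) false /\ is_exp (sp_res O VU x) y}}}.
pose W (i : I) := projT1 i.
pose WU (i : I) : W i `<=` U := projT1 (projT2 i).
pose y (i : I) : O (W i) := sval (projT2 (projT2 i)).
have yP (i : I) : y i \in sa_parity (O (W i)) false /\ is_exp (sp_res O (WU i) x) (y i).
  exact: svalP (projT2 (projT2 i)).
have cover : U `<=` \bigcup_i W i.
  move=> p Up; have [V [VU [yV [Vp eV VP]]]] := local_exp ex Up.
  by exists (existT _ V (existT _ VU (exist _ yV (conj eV VP)))).
have [|t [ts _]] := @sm_sheafP _ _ _ M I U W WU cover y.
  move=> i j V Vi Vj; have VU := subset_trans Vi (WU i).
  have hi := is_exp_res (VU := Vi) (yP i).2; have hj := is_exp_res (VU := Vj) (yP j).2.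
  rewrite (sp_res_comp _ _ VU) in hi; rewrite (sp_res_comp _ _ VU) in hj.
  exact: is_exp_uniq hi hj.
exists t; first by apply: (even_local (sm_sheafP M) cover) => i; rewrite ts; case: (yP i).
apply/is_expP => c p Up dp; have [i _ Wp] := cover p Up.
rewrite -!(point_jet_res (WU i) Up Wp) ts.
by have /is_expP := (yP i).2; apply.
Qed.

Lemma is_expD U (x x' y y' : O U) :
  x \in sa_parity (O U) false -> x' \in sa_parity (O U) false ->
  is_exp x y -> is_exp x' y' -> is_exp (x + x') (y * y').
Proof.
move=> ex ex' /is_expP xy /is_expP xy'; apply/is_expP => c p Up dp.
rewrite rmorphM rmorphD xy xy' [RHS]gexpD //.
  exact: (sa_fun_parity (point_jet Up dp) ex).
exact: (sa_fun_parity (point_jet Up dp) ex').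
Qed.

Lemma is_exp0 U : is_exp (0 : O U) 1.
Proof. by apply/is_expP => c p Up dp; rewrite rmorph0 rmorph1 [RHS]gexp0. Qed.

(** The inverse of e^x is e^(-x). *)
Lemma is_exp_unit U (x y : O U) : x \in sa_parity (O U) false ->
  is_exp x y -> invertible y.
Proof.
move=> ex xy; have eNx : - x \in sa_parity (O U) false by rewrite rpredN.
have [y' _ xy'] := exp_exists eNx.
exists y'; split; apply/esym/(is_exp_uniq (@is_exp0 U)).
  by rewrite -(subrr x); exact: is_expD.
by rewrite -(addNr x); exact: is_expD.
Qed.

Lemma even_scale U (a : C) (x : O U) : x \in sa_parity (O U) false ->
  sa_scal (O U) a * x \in sa_parity (O U) false.
Proof. by move=> ex; exact: (sa_parityM (sa_scal_even _ a) ex). Qed.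

Lemma exp_section_exists U (s : even_sheaf M U) : exists t : even_unit_sheaf M U,
  is_exp (sa_scal (O U) (two_pi_i R) * val s) (val t).
Proof.
have ex := even_scale (two_pi_i R) (valP s).
have [y ey yP] := exp_exists ex.
have uy : y \in @even_unit_pred _ (O U) by apply/even_unitP; split=> //; exact: is_exp_unit yP.
by exists (exist _ y uy).
Qed.

Definition exp_fun U (s : even_sheaf M U) : even_unit_sheaf M U :=
  sval (cid (exp_section_exists s)).

Lemma exp_funP U (s : even_sheaf M U) (t : even_unit_sheaf M U) :
  exp_fun s = t <-> is_exp (sa_scal (O U) (two_pi_i R) * val s) (val t).
Proof.
rewrite /exp_fun; case: cid => t' /= t'P; split=> [<- //|tP].
by apply: val_inj; exact: is_exp_uniq t'P tP.
Qed.

Lemma exp_fun_nmod U : nmod_morphism (@exp_fun U).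
Proof.
split=> [|s t]; apply/exp_funP.
  rewrite (_ : _ * _ = 0) ?mulr0 //; exact: is_exp0.
rewrite (_ : val (s + t) = val s + val t) // mulrDr.
by apply: is_expD; try exact: even_scale (valP _); exact/exp_funP.
Qed.

HB.instance Definition _ U :=
  GRing.isNmodMorphism.Build _ _ (@exp_fun U) (@exp_fun_nmod U).

Lemma exp_fun_res U V (VU : V `<=` U) (s : even_sheaf M U) :
  exp_fun (ab_res (even_sheaf M) VU s) = ab_res (even_unit_sheaf M) VU (exp_fun s).
Proof.
apply/exp_funP; rewrite /= -(sa_fun_scal (sp_res O VU)) -rmorphM.
by apply: is_exp_res; exact/exp_funP.
Qed.

Definition exp_hom : ab_hom (even_sheaf M) (even_unit_sheaf M) :=
  @AbHom M (even_sheaf M) (even_unit_sheaf M) (fun U => @exp_fun U) exp_fun_res.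

Lemma two_pi_i_neq0 : two_pi_i R != 0.
Proof.
by rewrite /two_pi_i eq_complex /= eqxx /= mulf_neq0 ?pnatr_eq0 // gt_eqF // pi_gt0.
Qed.

(** In a chart, the body of an invertible section avoids 0, so it has a logarithm on a
    neighbourhood by [local_log], and [superdomain_log] gives one for the section
    itself. It is a logarithm in that chart; its intrinsic exponential agrees with
    the given section there, and sections over a chart domain are determined by that
    chart. *)
Lemma exp_surjective : ab_surjective exp_hom.
Proof.
move=> U t p Up; have [c dp] := sm_charts p.
have /even_unitP[et [t' [tt' t't]]] := valP t.
have idU : U `<=` U by [].
have t0 : body (point_jet Up dp (val t)) != 0.
  apply: (germ_invertible_body Up dp); exists U, idU; split=> //.
  by rewrite sp_res_id; exists t'.
have [L LP] := local_log t0.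
have [|W [WV [WU [Wp tW]]]] := @body_near _ _ _ _ c U p Up dp (val t)
   (fun w => [/\ w != 0, cexp (L w) = w & differentiable L w]).
  by apply: filterS2 (near_neq0 t0) LP => w w0 [].
pose V : opens M := pre c W; have eV := sa_fun_parity (sp_res O WU) et.
have [||x' ex' x'P] := @superdomain_log R n m W (ch_iso WV (sp_res O WU (val t))) L.
- exact: sa_fun_parity.
- by move=> z; rewrite -jetE; exact: tW.
have [g gK Kg] := ch_iso_bij WV.
have ex : g x' \in sa_parity (O V) false.
  by apply: (sa_hom_reflect_even (can_inj gK)); rewrite Kg.
have [y ey yP] := exp_exists ex.
exists V, WU; split; first by split.
exists (exist _ (sa_scal (O V) (two_pi_i R)^-1 * g x') (even_scale _ ex)).
apply/exp_funP.
suff e : sp_res O WU (val t) = y.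
  rewrite [X in is_exp X _](_ : _ = g x').
    by rewrite [X in is_exp _ X](_ : _ = y).
  rewrite -[val _]/(sa_scal (O V) (two_pi_i R)^-1 * g x') mulrA -rmorphM.
  by rewrite mulfV ?two_pi_i_neq0 // rmorph1 mul1r.
apply: (chart_sep (WV := WV)) => z.
have [_ _ surj] := ch_bij c; have [q dq qz] := surj (val z) (WV _ (set_mem (valP z))).
have Vq : opens_set V q by split=> //=; rewrite qz; exact: set_mem (valP z).
have jz (s : O V) : jet m z (ch_iso WV s) = point_jet Vq dq s.
  rewrite -(@chart_jetE _ _ _ _ c W WV V (@subset_refl _ _) z) //.
  by rewrite sp_res_id.
rewrite -(x'P z) -[in LHS](Kg x') !jz.
by move/is_expP: yP => ->.
Qed.

Lemma int_scal U (k : int) : (k%:~R : O U) = sa_scal (O U) k%:~R.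
Proof. by rewrite rmorph_int. Qed.

(** A nonzero integer is invertible in the complex numbers, and 1 is not 0 on a
    nonempty open set because stalks are local rings. *)
Lemma section_int_inj U p (a b : int) : opens_set U p ->
  (a%:~R : O U) = b%:~R -> a = b.
Proof.
move=> Up ab; apply/eqP; rewrite -subr_eq0; apply: contraT => d0.
have [/(_ U Up) one0 _] := @sm_local _ _ _ M p; case: one0.
have dC : ((a - b)%:~R : C) != 0 by rewrite intr_eq0.
rewrite -(rmorph1 (sa_scal (O U))) -(mulVf dC) rmorphM -int_scal.
have -> : ((a - b)%:~R : O U) = 0 by rewrite intrB ab subrr.
by rewrite mulr0.
Qed.

Lemma int_incl_inj U : injective (int_incl M U).
Proof.
move=> k l kl; apply: val_inj; apply/funext => x.
have [V [VU Vx kV]] := lcst_nbhd k x; have [V' [V'U V'x lV']] := lcst_nbhd l x.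
have WU : opensI V V' `<=` U by move=> q [/VU].
apply: (@section_int_inj (opensI V V') (val x)); first by [].
have <- := @int_inclP _ _ _ M U k (opensI V V') WU (val k x) (fun y Vy => kV y Vy.1).
have <- := @int_inclP _ _ _ M U l (opensI V V') WU (val l x) (fun y Vy => lV' y Vy.2).
by rewrite -[int_incl_fun k]/(int_incl M U k) kl.
Qed.

Lemma exp_int U (k : int_sheaf M U) : exp_fun (int_incl M U k) = 0.
Proof.
apply/exp_funP; apply/is_expP => c p Up dp.
pose x : U := exist _ p (mem_set Up).
have [V [VU Vx kV]] := lcst_nbhd k x.
rewrite rmorph1 -(point_jet_res VU Up Vx dp) rmorphM.
rewrite [val _](_ : _ = val (int_incl_fun k)) // (@int_inclP _ _ _ M U k V VU (val k x)) //.
rewrite int_scal sa_fun_scal -rmorphM sa_fun_scal.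
exact/esym/gexp_int.
Qed.

(** At each point of a chart the value of s is an integer by [gexp_eq1]; the body is
    continuous, so that integer is constant near [p]. *)
Lemma exp_kernel_local U (s : even_sheaf M U) p : opens_set U p -> exp_fun s = 0 ->
  exists (V : opens M) (VU : V `<=` U) (k : int),
    opens_set V p /\ sp_res O VU (val s) = k%:~R.
Proof.
move=> Up /exp_funP /is_expP s1; have [c dp] := sm_charts p.
have sint q (Uq : opens_set U q) (dq : opens_set (ch_dom c) q) :
    exists k : int, point_jet Uq dq (val s) = sa_scal SL k%:~R.
  have := s1 c q Uq dq; rewrite rmorph1 => /esym /gexp_eq1[k].
  rewrite rmorphM sa_fun_scal => kE; exists k.
  have := congr1 ( *%R (sa_scal SL (two_pi_i R)^-1)) kE.
  rewrite mulrA -rmorphM mulVf ?two_pi_i_neq0 // rmorph1 mul1r => ->.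
  by rewrite -[grassmann_const _ _]/(sa_scal SL _) -rmorphM mulKf ?two_pi_i_neq0.
have bodyS (a : C) : body (sa_scal SL a) = a by rewrite [LHS]grassmann_const0.
have [k kE] := sint p Up dp.
have [|W [WV [WU [Wp sW]]]] := @body_near _ _ _ _ c U p Up dp (val s)
   (fun w => `|body (point_jet Up dp (val s)) - w| < 1).
  by apply: (@cvgr_dist_lt _ C _ (nbhs _) _ id); [exact: cvg_id | exact: ltr01].
exists (pre c W), WU, k; split; first by split.
apply: (chart_sep (WV := WV)) => z.
have [_ _ surj] := ch_bij c; have [q dq qz] := surj (val z) (WV _ (set_mem (valP z))).
have Uq : opens_set U q by apply: (WU); split=> //=; rewrite qz; exact: set_mem (valP z).
have [l lE] := sint q Uq dq.
(* Integers at distance less than 1 are equal. *)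
have := sW z; rewrite (chart_jetE WV WU _ Uq dq) // lE kE !bodyS -intrB -intr_norm.
rewrite ltrz1 => kl; rewrite int_scal !sa_fun_scal.
congr (sa_scal SL _%:~R); apply/eqP; rewrite eq_sym -subr_eq0 -normr_eq0.
by rewrite eq_le normr_ge0 andbT -ltzD1 add0r.
Qed.

Lemma exp_kernel U (s : even_sheaf M U) : exp_fun s = 0 ->
  exists k : int_sheaf M U, int_incl M U k = s.
Proof.
move=> s0.
have loc (x : U) : {k : int | exists (V : opens M) (VU : V `<=` U),
    opens_set V (val x) /\ sp_res O VU (val s) = k%:~R}.
  apply: cid; have [V [VU [k [Vx kE]]]] := exp_kernel_local (set_mem (valP x)) s0.
  by exists k, V, VU.
pose k (x : U) : int := sval (loc x).
have lk : k \in @lcst_pred M U.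
  apply/asboolP => x; have [V [VU [Vx kE]]] := svalP (loc x).
  have : nbhs (val x) (opens_set V).
    by apply: open_nbhs_nbhs; split=> //; exact: opens_open.
  apply: filterS => y Vy Uy.
  have [V' [V'U [V'y k'E]]] := svalP (loc (exist _ y Uy)).
  apply: (@section_int_inj (opensI V V') y); first by [].
  have WU : opensI V V' `<=` U by move=> q [/VU].
  transitivity (sp_res O WU (val s)).
    by rewrite -(sp_res_comp V'U (@subIsetr _ V V' : opensI V V' `<=` V') WU) k'E rmorph_int.
  by rewrite -(sp_res_comp VU (@subIsetl _ V V' : opensI V V' `<=` V) WU) kE rmorph_int.
exists (exist _ k lk); apply/esym/int_incl_uniq => x.
by have [V [VU [Vx kE]]] := svalP (loc x); exists V, VU.
Qed.

End ExpHom.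

Theorem theorem11 (R : realType) (n m : nat) (M : supermanifold R n m) :
  exists exp : ab_hom (even_sheaf M) (even_unit_sheaf M),
    [/\ forall (U : opens M) (s : even_sheaf M U) (t : even_unit_sheaf M U),
          exp U s = t <->
          is_exp (sa_scal (sm_sheaf M U) (two_pi_i R) * val s) (val t),
        ab_surjective exp,
        forall U : opens M, injective (int_incl M U) &
        forall (U : opens M) (s : even_sheaf M U),
          exp U s = 0 <-> exists k : int_sheaf M U, int_incl M U k = s].
Proof.
exists (exp_hom M); split.
- by move=> U s t; exact: exp_funP.
- exact: exp_surjective.
- by move=> U; exact: int_incl_inj.
move=> U s; split; first exact: exp_kernel.
by case=> k <-; exact: exp_int.
Qed.
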